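(* Let $n \geq 2$, $N \geq 1$, and suppose $f \colon \mathbb{C}^n \dashrightarrow \mathbb{C}^N$ is a rational $m$-fold sphere map, where $1 \leq m \leq \infty$. (i) If $m < \infty$ and $f$ is a polynomial map of degree $m$ or less, then $f$ is an $\infty$-fold sphere map. (ii) If $m < \infty$ and $f$ is a rational map of degree $m-1$ or less, then $f$ is an $\infty$-fold sphere map. If $f$ is an $\infty$-fold sphere map, then $f$ is polynomial and for every $r > 0$ there exists an $R > 0$ such that $f(rS^{2n-1}) \subset RS^{2N-1}$. Moreover, in that case there exist a unitary $U \in U(\mathbb{C}^N)$ and homogeneous sphere maps (possibly constant) $h_j \colon \mathbb{C}^n \to \mathbb{C}^{\ell_j}$, $j=1,\ldots,k$, where $\ell_1+\cdots+\ell_k \leq N$, such that $$f = U ( h_1 \oplus \cdots \oplus h_k \oplus 0).$$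
   Context: $S^{2n-1}=\{z\in\mathbb{C}^n:\lVert z\rVert=1\}$ is the unit sphere in $\mathbb{C}^n$, and $rS^{2n-1}$ is the sphere of radius $r$ centered at the origin. Definition: a rational map $f \colon \mathbb{C}^n \dashrightarrow \mathbb{C}^N$ is an $m$-fold sphere map ($1\le m<\infty$) if there exist $2m$ numbers $0 < r_1 < r_2 < \cdots < r_m < \infty$ and $0 < R_1 , R_2 , \ldots , R_m < \infty$, such that the pole set of $f$ misses $r_mS^{2n-1}$ (and therefore $r_jS^{2n-1}$ for all $j$) and $f(r_jS^{2n-1}) \subset R_jS^{2N-1}$ for all $j = 1,\ldots,m$. If there are infinitely many such numbers $r_j$ and $R_j$ (infinitely many distinct radii $r_j$ with corresponding $R_j$, the pole set missing all the spheres $r_jS^{2n-1}$), then $f$ is an $\infty$-fold sphere map. The degree of a rational map $f=\frac{p}{q}$ in lowest terms ($p\colon\mathbb{C}^n\to\mathbb{C}^N$ and $q\colon\mathbb{C}^n\to\mathbb{C}$ polynomial with no nonconstant common factor) is the maximum of $\deg p$ and $\deg q$. A homogeneous sphere map is a map all of whose components are homogeneous polynomials of one common degree, and which is a $1$-fold sphere map (takes some sphere centered at the origin into a sphere of positive radius centered at the origin). For maps $g$ and $h$, $g\oplus h$ is the map whose components are those of $g$ followed by those of $h$; $\oplus\, 0$ means that zero components are added, if needed, to match the target dimension $N$. *)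

(* Defs.v *)
From mathcomp Require Import all_boot all_order all_algebra.
From mathcomp Require Export reals complex mpoly.

Set Implicit Arguments.
Unset Strict Implicit.
Unset Printing Implicit Defensive.

Import Order.TTheory GRing.Theory Num.Theory.

Local Open Scope ring_scope.

Section SphereMaps.
Context {R : realType}.
Local Notation C := R[i].

Definition enorm {n : nat} (z : 'cV[C]_n) : R :=
  Num.sqrt (\sum_i Normc.normc (z i 0) ^+ 2).

Definition peval {n : nat} (p : {mpoly C[n]}) (z : 'cV[C]_n) : C :=
  p.@[fun i => z i 0].

(* A polynomial map C^n -> C^N is a column vector of polynomials. *)
Definition pmap_eval {n N : nat} (g : 'cV[{mpoly C[n]}]_N) (z : 'cV[C]_n) :
    'cV[C]_N :=
  map_mx (fun p => peval p z) g.

(* [msize g <= 1] says that [g] is constant. *)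
Definition lowest_terms {n N : nat} (p : 'cV[{mpoly C[n]}]_N)
    (q : {mpoly C[n]}) : Prop :=
  forall (g b : {mpoly C[n]}) (a : 'cV[{mpoly C[n]}]_N),
    p = g *: a -> q = g * b -> (msize g <= 1)%N.

(* A rational map is given by a representation p / q in lowest terms, which
   exists and is unique up to a common nonzero constant factor. *)
Record ratmap (n N : nat) := RatMap {
  rnum : 'cV[{mpoly C[n]}]_N;
  rden : {mpoly C[n]};
  rden_neq0 : rden != 0;
  ratmap_lowest_terms : lowest_terms rnum rden
}.

Definition is_pole {n N : nat} (f : ratmap n N) (z : 'cV[C]_n) : Prop :=
  peval (rden f) z = 0.

(* Only meaningful when [z] is not a pole of [f]. *)
Definition rat_eval {n N : nat} (f : ratmap n N) (z : 'cV[C]_n) : 'cV[C]_N :=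
  (peval (rden f) z)^-1 *: pmap_eval (rnum f) z.

(* [msize p] is the degree of [p] plus one for [p != 0], and [msize 0 = 0]. *)
Definition mdegree {n : nat} (p : {mpoly C[n]}) : nat := (msize p).-1.

Definition rat_degree {n N : nat} (f : ratmap n N) : nat :=
  maxn (\max_i mdegree (rnum f i 0%R)) (mdegree (rden f)).

(* Equality p / q = g of rational maps. *)
Definition rat_eq_pmap {n N : nat} (f : ratmap n N)
    (g : 'cV[{mpoly C[n]}]_N) : Prop :=
  rnum f = rden f *: g.

Definition is_polynomial {n N : nat} (f : ratmap n N) : Prop :=
  exists g : 'cV[{mpoly C[n]}]_N, rat_eq_pmap f g.

Definition poles_miss_sphere {n N : nat} (f : ratmap n N) (r : R) : Prop :=
  forall z : 'cV[C]_n, enorm z = r -> ~ is_pole f z.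

(* f(r S^{2n-1}) is contained in s S^{2N-1}, where f(A) is the set of values of
   [f] at the points of A that are not poles. *)
Definition maps_sphere {n N : nat} (f : ratmap n N) (r s : R) : Prop :=
  forall z : 'cV[C]_n, enorm z = r -> ~ is_pole f z ->
    enorm (rat_eval f z) = s.

(* The clause on poles only concerns the largest radius, whose index [j]
   satisfies [j.+1 = m]. *)
Definition finite_fold_sphere_map {n N : nat} (m : nat) (f : ratmap n N) :
    Prop :=
  exists r s : 'I_m -> R,
    [/\ forall j, 0 < r j /\ 0 < s j,
        forall i j : 'I_m, (i < j)%N -> r i < r j,
        forall j : 'I_m, j.+1 = m -> poles_miss_sphere f (r j) &
        forall j : 'I_m, maps_sphere f (r j) (s j)].

Definition infinite_fold_sphere_map {n N : nat} (f : ratmap n N) : Prop :=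
  exists r s : nat -> R,
    [/\ forall j, 0 < r j /\ 0 < s j,
        injective r,
        forall j, poles_miss_sphere f (r j) &
        forall j, maps_sphere f (r j) (s j)].

(* [None] stands for m = infinity. *)
Definition fold_sphere_map {n N : nat} (m : option nat) (f : ratmap n N) :
    Prop :=
  if m is Some k then finite_fold_sphere_map k f
  else infinite_fold_sphere_map f.

Definition homogeneous_sphere_map {n l : nat} (h : 'cV[{mpoly C[n]}]_l) :
    Prop :=
  (exists d : nat, forall i, h i 0 \is d.-homog) /\
  (exists r s : R, [/\ 0 < r, 0 < s &
     forall z : 'cV[C]_n, enorm z = r -> enorm (pmap_eval h z) = s]).

(* h_1 (+) ... (+) h_k (+) 0 *)
Definition oplus0 {n N k : nat} (l : 'I_k -> nat)
    (h : forall j, 'cV[{mpoly C[n]}]_(l j)) (hl : (\sum_j l j <= N)%N) :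
    'cV[{mpoly C[n]}]_N :=
  castmx (subnKC hl, erefl 1%N)
    (col_mx (\mxcol_j h j) (0 : 'cV_(N - \sum_j l j))).

Definition mulmx_pmap {n N : nat} (U : 'M[C]_N) (g : 'cV[{mpoly C[n]}]_N) :
    'cV[{mpoly C[n]}]_N :=
  map_mx (@mpolyC n C) U *m g.

End SphereMaps.

Arguments ratmap R n N : clear implicits.

(* Main.v *)
Require Import Defs.
From mathcomp Require Import all_boot all_order all_algebra.
From mathcomp Require Import reals complex mpoly.
From mathcomp Require Import ring zify.
From mathcomp Require boolp.

Set Implicit Arguments.
Unset Strict Implicit.
Unset Printing Implicit Defensive.

Import Order.TTheory GRing.Theory Num.Theory.
Local Open Scope ring_scope.

(* Restrict to complex lines. For a unit vector u, |p(x u)|^2 x^d, where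
   d >= deg p, is on the circle |x|^2 = t a polynomial in x whose coefficients
   are polynomials in t of degree at most d, so that f = p / q maps |z|^2 = t_j
   into |w|^2 = rho_j exactly if, at t = t_j, the coefficients for p are rho_j
   times those for q. Let q vanish to order nu at the origin, and let A
   interpolate rho_j t_j^nu at d + 1 of the t_j. Comparing top coefficients gives
   deg A + deg q <= d + nu; then counting zeros yields
   |z|^(2 nu) |p(z)|^2 = A(|z|^2) |q(z)|^2 for all z, which polarizes to
     <z, w>^nu <p(z), p(w)> = A(<z, w>) q(z) conj(q(w)).
   As n >= 2, the orthogonal pairs (z, w) are too many for q(z) conj(q(w)) to
   vanish on all of them, which allows one to cancel <z, w>^nu. So q divides
   <p(z), p(w)> for every w, hence p, and f is a polynomial map with
   <f(z), f(w)> = A(<z, w>). For polynomial f of degree d this also follows from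
   d spheres only, the origin serving as a further one. Comparing bidegrees, the
   homogeneous components of f take their values in pairwise orthogonal
   subspaces, and have norms of the form c |z|^a. *)

(** * Polynomials in one variable: interpolation and coefficients along circles *)

Section Univariate.
Context {F : fieldType}.

Lemma poly_eq0_on_sequence (x : nat -> F) (p : {poly F}) :
  injective x -> (forall k, p.[x k] = 0) -> p = 0.
Proof.
move=> x_inj px0; apply: (@roots_geq_poly_eq0 _ _ (mkseq x (size p))).
- by apply/allP => y /mapP[k _ ->]; apply/rootP.
- by rewrite mkseq_uniq.
- by rewrite size_mkseq.
Qed.

Lemma poly_eq_on_points m (x : nat -> F) (p q : {poly F}) :
  {in gtn m &, injective x} -> (size p <= m)%N -> (size q <= m)%N ->
  (forall j, (j < m)%N -> p.[x j] = q.[x j]) -> p = q.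
Proof.
move=> x_inj sp sq epq; apply/eqP; rewrite -subr_eq0; apply/eqP.
apply: (@roots_geq_poly_eq0 _ _ (mkseq x m)).
- apply/allP => z /mapP[k]; rewrite mem_iota /= => km ->; apply/rootP.
  by rewrite hornerD hornerN epq ?subrr.
- rewrite map_inj_in_uniq ?iota_uniq // => i j.
  by rewrite !mem_iota /= !add0n => im jm; apply: x_inj.
- by rewrite size_mkseq (leq_trans (size_polyD _ _))// size_polyN geq_max sp.
Qed.

(** Newton interpolation: a new node is met by adding a multiple of the product that vanishes at all
    earlier nodes. *)
Lemma poly_interpolation m (x y : nat -> F) :
  {in gtn m &, injective x} ->
  exists2 p : {poly F}, (size p <= m)%N &
    forall j, (j < m)%N -> p.[x j] = y j.
Proof.
elim: m => [|m IHm] x_inj.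
  by exists 0; [rewrite size_poly0 | move=> j].
have [|p sp hp] := IHm.
  by move=> i j im jm; apply: x_inj; rewrite inE ltnW.
pose w := \prod_(j < m) ('X - (x j)%:P).
have wm : w.[x m] != 0.
  rewrite horner_prod prodf_seq_neq0; apply/allP => j _ /=.
  rewrite !hornerE subr_eq0; apply/eqP => /x_inj e.
  by have := ltn_ord j; rewrite -e ?ltnn ?inE// ltnW// ltnS.
have wj j : (j < m)%N -> w.[x j] = 0.
  move=> jm; rewrite horner_prod (bigD1 (Ordinal jm)) //=.
  by rewrite !hornerE subrr mul0r.
exists (p + ((y m - p.[x m]) / w.[x m]) *: w).
  rewrite (leq_trans (size_polyD _ _))// geq_max (leq_trans sp)//=.
  rewrite (leq_trans (size_scale_leq _ _))// size_prod_XsubC.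
  by rewrite /index_enum -enumT size_enum_ord.
move=> j; rewrite ltnS leq_eqVlt => /predU1P[->|jm]; rewrite !hornerE.
  by rewrite divfK // addrC subrK.
by rewrite (wj j jm) mulr0 addr0 hp.
Qed.

(* The coefficient of [x ^ l] in [x ^ d * \sum_(a, b <= d) K a b x ^ a y ^ b]
   once [y] is replaced by [t / x], as a polynomial in [t]. *)
Definition circle_coef d (K : nat -> nat -> F) (l : nat) : {poly F} :=
  \sum_(a < d.+1) \sum_(b < d.+1) ((d + a == l + b)%N%:R * K a b) *: 'X^b.

Lemma circle_coefE d K l t : (circle_coef d K l).[t] =
  \sum_(a < d.+1) \sum_(b < d.+1) (d + a == l + b)%N%:R * K a b * t ^+ b.
Proof.
rewrite horner_sum; apply: eq_bigr => a _; rewrite horner_sum.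
by apply: eq_bigr => b _; rewrite !hornerE.
Qed.

Lemma coef_circle_coef d K l k : (circle_coef d K l)`_k =
  \sum_(a < d.+1) ((k <= d) && (d + a == l + k))%N%:R * K a k.
Proof.
rewrite coef_sum; apply: eq_bigr => a _; rewrite coef_sum.
have [kd|kd] := leqP k d; last first.
  rewrite mul0r big1 // => b _; rewrite coefZ coefXn.
  by rewrite [(k == b :> nat)]gtn_eqF ?mulr0 // (leq_trans (ltn_ord b)).
rewrite (bigD1 (inord k)) //= coefZ coefXn inordK ?ltnS // eqxx mulr1.
rewrite big1 ?addr0 // => b bk; rewrite coefZ coefXn.
rewrite [(k == b :> nat)](_ : _ = false) ?mulr0 //.
by apply: contraNF bk => /eqP ->; rewrite inord_val.
Qed.

Lemma circle_coefB d K L c l :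
  circle_coef d (fun a b => K a b - c * L a b) l =
  circle_coef d K l - c *: circle_coef d L l.
Proof.
rewrite /circle_coef scaler_sumr -sumrB; apply: eq_bigr => a _.
rewrite scaler_sumr -sumrB; apply: eq_bigr => b _.
by rewrite scalerA -scalerBl; congr (_ *: _); ring.
Qed.

(** On [x * y = t] the monomial [x ^ a * y ^ b] is [t ^ b] times the power [a - b] of [x]. The
    factor [x ^ d] shifts these exponents, which lie between [-d] and [d], to the range of [l]. *)
Lemma sum_circle_coef d K x y :
  \sum_(l < (d + d).+1) (circle_coef d K l).[x * y] * x ^+ l =
  x ^+ d * \sum_(a < d.+1) \sum_(b < d.+1) K a b * x ^+ a * y ^+ b.
Proof.
rewrite (eq_bigr (fun l : 'I_(d + d).+1 => \sum_(a < d.+1) \sum_(b < d.+1)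
   (d + a == l + b)%N%:R * K a b * (x * y) ^+ b * x ^+ l)); last first.
  move=> l _; rewrite circle_coefE mulr_suml; apply: eq_bigr => a _.
  by rewrite mulr_suml.
rewrite exchange_big mulr_sumr; apply: eq_bigr => a _ /=.
rewrite exchange_big mulr_sumr; apply: eq_bigr => b _ /=.
have lt_l : (d + a - b < (d + d).+1)%N by have := ltn_ord a; lia.
rewrite (bigD1 (Ordinal lt_l)) //= big1 ?addr0.
  have -> : (d + a == d + a - b + b)%N by have := ltn_ord b; lia.
  have -> : x ^+ d * (K a b * x ^+ a * y ^+ b) = K a b * y ^+ b * x ^+ (d + a).
    by rewrite exprD; ring.
  have -> : (d + a = b + (d + a - b))%N by have := ltn_ord b; lia.
  by rewrite exprD [(b + _ - b)%N]addKn exprMn mul1r; ring.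
move=> l; rewrite -val_eqE /= => nl.
rewrite [_ == _](_ : _ = false) ?mul0r //.
by apply/negbTE; move: nl; apply: contraNN => /eqP ->; rewrite addnK.
Qed.

(** A Laurent polynomial in [x] with infinitely many zeros is zero. Multiplying by [q] covers the
    points where [q] vanishes, about which the hypothesis says nothing. *)
Lemma circle_coef_eq0 d (K : nat -> nat -> F) t (x : nat -> F) (q : {poly F}) :
  q != 0 ->
  injective x -> (forall k, x k != 0) ->
  (forall k, q.[x k] != 0 ->
     \sum_(a < d.+1) \sum_(b < d.+1) K a b * x k ^+ a * (t / x k) ^+ b = 0) ->
  forall l, (l < (d + d).+1)%N -> (circle_coef d K l).[t] = 0.
Proof.
move=> q0 x_inj x0 hK l ltl.
pose h := \poly_(l < (d + d).+1) (circle_coef d K l).[t].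
suff h0 : h = 0 by have := coef0 F l; rewrite -h0 coef_poly ltl.
suff /eqP : h * q = 0 by rewrite mulf_eq0 (negbTE q0) orbF => /eqP.
apply: (poly_eq0_on_sequence x_inj) => k; rewrite hornerM.
have [->|qk] := eqVneq q.[x k] 0; first by rewrite mulr0.
have et : t = x k * (t / x k) by rewrite mulrC divfK.
by rewrite horner_poly [in X in X * _]et sum_circle_coef hK // mulr0 mul0r.
Qed.

Lemma size_circle_coef d K l : (size (circle_coef d K l) <= d.+1)%N.
Proof.
apply/leq_sizeP => k dk; rewrite coef_circle_coef big1 // => a _.
by rewrite leqNgt dk mul0r.
Qed.

(* Comparing the coefficients of [x ^ (d + D - nu)] bounds the degree of [A];
   this bound makes both sides of the identity polynomials of degree at most
   [d], apart from the factor ['X^nu], which agree at [d + 1] points. *)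
Lemma circle_coef_identity d nu D (K : nat -> nat -> F) (u v : nat -> F)
    (t rho : nat -> F) (A : {poly F}) :
  (nu <= D)%N -> (D <= d)%N ->
  (forall a, (a < nu)%N -> u a = 0 /\ v a = 0) ->
  (forall a, (D < a)%N -> u a = 0 /\ v a = 0) ->
  u D != 0 -> v nu != 0 ->
  {in gtn d.+1 &, injective t} ->
  (forall j, (j < d.+1)%N -> t j != 0) ->
  (size A <= d.+1)%N ->
  (forall j, (j < d.+1)%N -> A.[t j] = rho j * t j ^+ nu) ->
  (forall j l, (j < d.+1)%N -> (l < (d + d).+1)%N ->
     (circle_coef d K l).[t j] =
     rho j * (circle_coef d (fun a b => u a * v b) l).[t j]) ->
  forall l, (l < (d + d).+1)%N ->
    'X^nu * circle_coef d K l = A * circle_coef d (fun a b => u a * v b) l.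
Proof.
move=> nuD Dd uv_lt uv_gt uD vnu t_inj t0 sA At KL.
set L := fun a b => _ in KL *.
have sA' : (size A <= (d + nu - D).+1)%N.
  (* On the support of [L], [a <= D] and [nu <= b], so [a - b = D - nu] only for [a = D] and
     [b = nu]: this coefficient of [L] is a single monomial. *)
  pose l0 := (d + D - nu)%N.
  have L0 : circle_coef d L l0 = (u D * v nu) *: 'X^nu.
    apply/polyP => k; rewrite coef_circle_coef coefZ coefXn.
    have [->|k_nu] := eqVneq k nu.
      rewrite (bigD1 (inord D)) //= inordK // big1 => [|a aD].
        rewrite [(_ && _)%N](_ : _ = true) ?mul1r ?mulr1 ?addr0 //.
        by rewrite (leq_trans nuD) //=; apply/eqP; rewrite /l0; lia.
      rewrite [(_ && _)%N](_ : _ = false) ?mul0r //; apply/negP => /andP[_].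
      rewrite /l0 => /eqP e; have eaD : a = D :> nat by lia.
      by move: aD; rewrite -eaD inord_val eqxx.
    rewrite mulr0 big1 // => a _.
    have [/andP[_ /eqP e]|] := boolP (_ && _)%N; last by rewrite mul0r.
    rewrite mul1r /L; have [/uv_lt[_ ->]|nuk] := ltnP k nu; first by rewrite mulr0.
    have /uv_gt[-> _] : (D < a)%N by move: e k_nu nuk; rewrite /l0; lia.
    by rewrite mul0r.
  have eA : circle_coef d K l0 = (u D * v nu) *: A.
    apply: (poly_eq_on_points t_inj) => [||j jd].
    - exact: size_circle_coef.
    - exact: leq_trans (size_scale_leq _ _) _.
    - by rewrite KL // ?/l0; [rewrite L0 !hornerZ hornerXn At //; ring | lia].
  (* At the index [l0] only the exponents [b = a + nu - D] occur, and [a <= d] bounds them. *)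
  rewrite -(size_scale A (a := u D * v nu)) ?mulf_neq0 // -eA.
  apply/leq_sizeP => k dk; rewrite coef_circle_coef big1 // => a _.
  rewrite [(_ && _)%N](_ : _ = false) ?mul0r //; apply/negP => /andP[_ /eqP].
  by have := ltn_ord a; rewrite /l0; lia.
move=> l ltl; set P := circle_coef d K l; set Q := circle_coef d L l.
have Q_nu : Q = 'X^nu * drop_poly nu Q.
  rewrite mulrC -{1}(poly_take_drop nu Q) [take_poly _ _](_ : _ = 0) ?add0r //.
  apply/polyP => k; rewrite coef_take_poly coef0; case: ifP => // knu.
  rewrite coef_circle_coef big1 // => a _.
  by rewrite /L (proj2 (uv_lt k knu)) !mulr0.
have sQ : (size (drop_poly nu Q) <= (D - nu).+1)%N.
  rewrite size_drop_poly leq_subLR.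
  apply/leq_sizeP => k dk; rewrite coef_circle_coef big1 // => a _.
  by rewrite /L (proj2 (uv_gt k _)) ?mulr0 //; lia.
(* The degree bounds [d + nu - D] and [D - nu] add up to [d], so [d + 1] points decide. *)
suff -> : P = A * drop_poly nu Q by rewrite [in RHS]Q_nu; ring.
apply: (poly_eq_on_points t_inj) => [||j jd].
- exact: size_circle_coef.
- by rewrite (leq_trans (size_polyMleq _ _)) //; lia.
- rewrite KL // -/Q hornerM At // -mulrA; congr (_ * _).
  by rewrite [in LHS]Q_nu hornerM hornerXn.
Qed.

(* Only [d] points are needed because every coefficient but that of [x ^ d] has
   degree less than [d] or vanishes at [0]. *)
Lemma circle_coef_const d (K : nat -> nat -> F) (t : nat -> F) (A : {poly F}) :
  {in gtn d &, injective t} ->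
  (forall j, (j < d)%N -> t j != 0) ->
  (size A <= d.+1)%N -> A.[0] = K 0%N 0%N ->
  (forall j l, (j < d)%N -> (l < (d + d).+1)%N ->
     (circle_coef d K l).[t j] = (l == d)%:R * A.[t j]) ->
  forall l, (l < (d + d).+1)%N -> circle_coef d K l = (l == d)%:R *: A.
Proof.
move=> t_inj t0 sA A0 KA l ltl.
have sR : (size ((l == d)%:R *: A) <= d.+1)%N.
  exact: leq_trans (size_scale_leq _ _) sA.
(* For [l > d] every exponent is [b = d + a - l < d]. *)
have [dl|ld] := ltnP d l.
  rewrite gtn_eqF // scale0r; apply: (poly_eq_on_points t_inj).
  - apply/leq_sizeP => k dk; rewrite coef_circle_coef big1 // => a _.
    rewrite [(_ && _)%N](_ : _ = false) ?mul0r //; apply/negP => /andP[_ /eqP].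
    by have := ltn_ord a; lia.
  - by rewrite size_poly0.
  - by move=> j jd; rewrite KA // gtn_eqF // mul0r horner0.
(* For [l <= d] the point [0] is the missing node: only [b = 0] contributes there, and [d + a = l]
   then forces [a = 0] and [l = d]. *)
pose t' j := if j is k.+1 then t k else 0.
have t'_inj : {in gtn d.+1 &, injective t'}.
  move=> [|i] [|j] //=; rewrite !inE !ltnS => id jd e.
  - by have := t0 j jd; rewrite -e eqxx.
  - by have := t0 i id; rewrite e eqxx.
  - by rewrite (t_inj i j).
apply: (poly_eq_on_points t'_inj (size_circle_coef d K l) sR) => -[_|j].
  rewrite /t' hornerZ A0 horner_coef0 coef_circle_coef.
  rewrite (bigD1 ord0) //= big1 => [|a a0]; rewrite addn0.
    by rewrite addr0 addn0 eq_sym.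
  rewrite [_ == _](_ : _ = false) ?mul0r //; apply/negP => /eqP e.
  by move: a0; rewrite -val_eqE /=; lia.
by rewrite ltnS => jd; rewrite hornerZ KA.
Qed.

End Univariate.

(** By induction on [n], reading [p] through [muni] as a polynomial in the last variable. Natural
    numbers serve as test points because conjugation fixes them. *)
Lemma mpoly_eq0_on_nat (F : numFieldType) n (p : {mpoly F[n]}) :
  (forall v : 'I_n -> nat, p.@[fun i => (v i)%:R] = 0) -> p = 0.
Proof.
elim: n p => [|n IHn] p p0.
  have := p0 (fun=> 0%N); rewrite (msize1_polyC (p := p)) ?mevalC => [->|].
    by rewrite mpolyC0.
  by rewrite msizeE; apply/bigmax_leqP_seq => m _ _; rewrite mdegE big_ord0.
pose w (i : 'I_n) := widen_ord (leqnSn n) i.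
have p_muni (v : 'I_n.+1 -> F) :
    p.@[v] = \sum_(k < size (muni p)) ((muni p)`_k).@[v \o w] * v ord_max ^+ k.
  transitivity ((muni p).[(v ord_max)%:MP]).@[v \o w]; last first.
    rewrite horner_coef raddf_sum; apply: eq_bigr => k _.
    by rewrite /= mevalM rmorphXn /= mevalC.
  rewrite muniE mevalE horner_sum raddf_sum; apply: eq_bigr => m _.
  rewrite /= !hornerZ hornerXn mevalM mevalZ mevalX rmorphXn /= mevalC.
  rewrite big_ord_recr /= mulrA; congr (_ * _ * _).
  by apply: eq_bigr => i _; rewrite mnmE.
have muni0 : muni p = 0.
  apply/polyP => k; rewrite coef0; apply: IHn => v.
  pose P := \poly_(k < size (muni p)) ((muni p)`_k).@[fun i => (v i)%:R : F].
  suff P0 : P = 0.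
    have := coef0 F k; rewrite -P0 coef_poly; case: ltnP => // sk _.
    by rewrite nth_default // meval0.
  apply: (@poly_eq0_on_sequence _ (fun j : nat => j%:R)) => [i j /eqP|j].
    by rewrite eqr_nat => /eqP.
  pose v' i := if unlift ord_max i is Some i' then v i' else j.
  have := p0 v'; rewrite p_muni /v' unlift_none => e.
  rewrite horner_poly -[RHS]e; apply: eq_bigr => l _; congr (_ * _).
  apply: meval_eq => i /=; rewrite (_ : w i = lift ord_max i) ?liftK //.
  by apply: val_inj; rewrite /= /bump leqNgt ltn_ord.
(* [muni] is injective: the coefficient of [p] at [m] reappears in [muni p] at the last exponent of
   [m] and the truncation [m']. *)
apply/mpolyP => m; rewrite mcoeff0.
pose m' := [multinom m (w i) | i < n].
transitivity (((muni p)`_(m ord_max))@_m'); last by rewrite muni0 coef0 mcoeff0.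
rewrite muniE coef_sum raddf_sum {1}[p]mpolyE raddf_sum.
apply: eq_bigr => m1 _; rewrite coefZ coefXn /= mcoeffZ mcoeffX.
rewrite [in RHS]mulr_natr mcoeffMn mcoeffZ mcoeffX.
rewrite -[RHS]mulr_natr -mulrA -natrM.
congr (_ * _%:R); rewrite mulnb; congr (nat_of_bool _).
apply/eqP/andP => [->|[/eqP e1 /eqP e2]]; first by rewrite !eqxx.
apply/mnmP => i; have [j ->|->] := unliftP ord_max i; last by rewrite e2.
have -> : lift ord_max j = w j.
  by apply: val_inj; rewrite /= /bump leqNgt ltn_ord.
by have /mnmP/(_ j) := e1; rewrite !mnmE.
Qed.

(** * Polynomials in [z] and the conjugate of [w] *)

Section Sesquipolynomials.
Context {C : numClosedFieldType}.

Lemma meval_conj n (p : {mpoly C[n]}) (v : 'I_n -> C) :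
  (p.@[v])^* = (map_mpoly Num.conj p).@[fun i => (v i)^*].
Proof.
have -> : map_mpoly Num.conj p =
    \sum_(m <- msupp p) (p@_m)^* *: 'X_[m] :> {mpoly C[n]}.
  rewrite {1}[p]mpolyE (raddf_sum (map_mpoly (S:=C) (Num.conj : C -> C))).
  by apply: eq_bigr => m _; rewrite /= map_mpolyZ map_mpolyX.
rewrite mevalE raddf_sum rmorph_sum; apply: eq_bigr => m _ /=.
rewrite mevalZ mevalX rmorphM rmorph_prod; congr (_ * _).
by apply: eq_bigr => i _; rewrite rmorphXn.
Qed.

Definition hdot n (z w : 'I_n -> C) : C := \sum_i z i * (w i)^*.

Section HermitianProduct.
Context (n : nat).
Implicit Types (u v w : 'I_n -> C).

Lemma hdotDr u v w : hdot u (fun i => v i + w i) = hdot u v + hdot u w.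
Proof.
by rewrite -big_split; apply: eq_bigr => i _; rewrite rmorphD mulrDr.
Qed.

Lemma hdotZr c u v : hdot u (fun i => c * v i) = c^* * hdot u v.
Proof.
by rewrite mulr_sumr; apply: eq_bigr => i _; rewrite rmorphM mulrCA.
Qed.

Lemma hdotBl u v w : hdot (fun i => u i - v i) w = hdot u w - hdot v w.
Proof. by rewrite -sumrB; apply: eq_bigr => i _; rewrite mulrBl. Qed.

Lemma hdotZl c u v : hdot (fun i => c * u i) v = c * hdot u v.
Proof. by rewrite mulr_sumr; apply: eq_bigr => i _; rewrite mulrA. Qed.

Lemma hdot_delta u j : hdot u (fun i => (i == j)%:R) = u j.
Proof.
rewrite /hdot (bigD1 j) //= eqxx conjC1 mulr1 big1 ?addr0 // => i /negbTE ->.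
by rewrite conjC0 mulr0.
Qed.

Lemma hdot_ge0 u : 0 <= hdot u u.
Proof. by apply: sumr_ge0 => i _; apply: mul_conjC_ge0. Qed.

End HermitianProduct.

Definition join n (z w : 'I_n -> C) (i : 'I_(n + n)) : C :=
  match split i with inl j => z j | inr j => w j end.

Lemma joinl n (z w : 'I_n -> C) i : join z w (lshift n i) = z i.
Proof. by rewrite /join -/(unsplit (inl i)) unsplitK. Qed.

Lemma joinr n (z w : 'I_n -> C) i : join z w (rshift n i) = w i.
Proof. by rewrite /join -/(unsplit (inr i)) unsplitK. Qed.

Lemma join_eta n (v : 'I_(n + n) -> C) :
  v =1 join (fun i => v (lshift n i)) (fun i => v (rshift n i)).
Proof. by move=> i; case: (split_ordP i) => j ->; rewrite ?joinl ?joinr. Qed.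

(** Identities between such functions become identities between the representing [H], in a
    polynomial ring without zero divisors. *)
Definition sesquipoly n (F : ('I_n -> C) -> ('I_n -> C) -> C) :=
  exists H : {mpoly C[n + n]},
    forall z w, F z w = H.@[join z (fun i => (w i)^*)].

Section Closure.
Context (n : nat).
Implicit Types F G : ('I_n -> C) -> ('I_n -> C) -> C.

Lemma sesquipoly_const c : sesquipoly (fun _ _ : 'I_n -> C => c).
Proof. by exists c%:MP => z w; rewrite mevalC. Qed.

Lemma sesquipoly_holo (p : {mpoly C[n]}) : sesquipoly (fun z _ => p.@[z]).
Proof.
exists (p \mPo [tuple 'X_(lshift n i) | i < n]) => z w.
rewrite comp_mpoly_meval; apply: meval_eq => i.
by rewrite tnth_mktuple mevalXU joinl.
Qed.

Lemma sesquipoly_antiholo (p : {mpoly C[n]}) :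
  sesquipoly (fun _ w => (p.@[w])^*).
Proof.
exists ((map_mpoly Num.conj p) \mPo [tuple 'X_(rshift n i) | i < n]) => z w.
rewrite comp_mpoly_meval meval_conj; apply: meval_eq => i.
by rewrite tnth_mktuple mevalXU joinr.
Qed.

Lemma sesquipolyB F G : sesquipoly F -> sesquipoly G ->
  sesquipoly (fun z w => F z w - G z w).
Proof.
by move=> [H FH] [J GJ]; exists (H - J) => z w; rewrite mevalB FH GJ.
Qed.

Lemma sesquipolyM F G : sesquipoly F -> sesquipoly G ->
  sesquipoly (fun z w => F z w * G z w).
Proof.
by move=> [H FH] [J GJ]; exists (H * J) => z w; rewrite mevalM FH GJ.
Qed.

Lemma sesquipolyX F k : sesquipoly F -> sesquipoly (fun z w => F z w ^+ k).
Proof.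
by move=> [H FH]; exists (H ^+ k) => z w; rewrite rmorphXn /= FH.
Qed.

Lemma sesquipoly_sum m (F : 'I_m -> ('I_n -> C) -> ('I_n -> C) -> C) :
  (forall i, sesquipoly (F i)) -> sesquipoly (fun z w => \sum_i F i z w).
Proof.
elim: m F => [|m IHm] F sF.
  by exists 0 => z w; rewrite big_ord0 meval0.
have [J HJ] := IHm (fun i => F (lift ord0 i)) (fun i => sF _).
have [K HK] := sF ord0.
by exists (K + J) => z w; rewrite big_ord_recl mevalD -HJ -HK.
Qed.

Lemma sesquipoly_horner (A : {poly C}) F : sesquipoly F ->
  sesquipoly (fun z w => A.[F z w]).
Proof.
move=> sF; have [|H HH] := @sesquipoly_sum (size A)
  (fun i z w => A`_i * F z w ^+ i).
  by move=> i; apply: sesquipolyM (sesquipoly_const _) (sesquipolyX _ sF).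
by exists H => z w; rewrite horner_coef HH.
Qed.

Lemma sesquipoly_hdot : sesquipoly (@hdot n).
Proof.
have [|H HH] := @sesquipoly_sum n (fun i z w => z i * (w i)^*).
  move=> i; apply: sesquipolyM.
    have [H HH] := sesquipoly_holo 'X_i.
    by exists H => z w; rewrite -HH mevalXU.
  have [H HH] := sesquipoly_antiholo 'X_i.
  by exists H => z w; rewrite -HH mevalXU.
by exists H => z w; rewrite -HH.
Qed.

(** For [z = x + 'i y] with [x], [y] real, [F z z] is a polynomial in [x] and [y]; it vanishes at
    natural vectors, hence identically. Complex [x] and [y] then reach all pairs of [z] and [w]. *)
Lemma sesquipoly_polarization F : sesquipoly F ->
  (forall z, F z z = 0) -> forall z w, F z w = 0.
Proof.
move=> [H FH] F0 z w.
pose lin (s : C) (j : 'I_n) : {mpoly C[n + n]} :=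
  'X_(lshift n j) + s *: 'X_(rshift n j).
pose H' := H \mPo [tuple (match split i with
  inl j => lin 'i j | inr j => lin (- 'i) j end) | i < n + n].
have H'E v : H'.@[v] =
    H.@[join (fun j => v (lshift n j) + 'i * v (rshift n j))
             (fun j => v (lshift n j) - 'i * v (rshift n j))].
  rewrite comp_mpoly_meval; apply: meval_eq => i.
  rewrite tnth_mktuple /join; case: (split i) => j;
  by rewrite /lin mevalD mevalZ !mevalXU // mulNr.
have H'0 : H' = 0.
  apply: mpoly_eq0_on_nat => v; rewrite H'E.
  rewrite -[RHS](F0 (fun j => (v (lshift n j))%:R + 'i * (v (rshift n j))%:R)).
  rewrite FH; apply: meval_eq => i; rewrite /join; case: (split i) => j //.
  by rewrite rmorphD rmorphM /= conjC_nat conjCi conjC_nat mulNr.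
(* The solution of [x + 'i y = z] and [x - 'i y = w^*]. *)
pose v := join (fun j => (z j + (w j)^*) / 2%:R)
               (fun j => (z j - (w j)^*) / (2%:R * 'i)).
have := meval0 v; rewrite -[X in X.@[_]]H'0 H'E FH => <-.
have i0 : 'i != 0 :> C by exact: neq0Ci.
have n20 : 2%:R != 0 :> C by rewrite pnatr_eq0.
by apply: meval_eq => i; rewrite /join -/(join _ _);
  case: (split i) => j; rewrite /v joinl joinr; field; rewrite i0.
Qed.

(** The product of the representing polynomials vanishes at natural points, so one of the two is
    zero. *)
Lemma sesquipoly_cancel F G : sesquipoly F -> sesquipoly G ->
  (forall z w, F z w * G z w = 0) -> ~ (forall z w, F z w = 0) ->
  forall z w, G z w = 0.
Proof.
move=> [H FH] [J GJ] FG F0 z w.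
have /eqP : H * J = 0.
  apply: mpoly_eq0_on_nat => v; pose v' i : C := (v i)%:R.
  rewrite mevalM.
  rewrite -[RHS](FG (fun i => v' (lshift n i)) (fun i => v' (rshift n i))).
  rewrite FH GJ; congr (_ * _); apply: meval_eq => i;
  rewrite [LHS](join_eta v' i) /join; case: (split i) => j //;
  by rewrite /v' conjC_nat.
rewrite mulf_eq0 => /orP[|] /eqP e; last by rewrite GJ e meval0.
by case: F0 => z' w'; rewrite FH e meval0.
Qed.

End Closure.
End Sesquipolynomials.

(** * Orthogonal pairs, and identities on spheres obtained along complex lines *)

Section SphereIdentities.
Context {C : numClosedFieldType}.

Lemma meval_curve n (p : {mpoly C[n]}) (c : 'I_n -> {poly C}) :
  exists P : {poly C}, forall s, P.[s] = p.@[fun i => (c i).[s]].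
Proof.
exists (\sum_(m <- msupp p) p@_m *: \prod_i c i ^+ m i) => s.
rewrite mevalE horner_sum; apply: eq_bigr => m _; rewrite hornerZ horner_prod.
by congr (_ * _); apply: eq_bigr => i _; rewrite horner_exp.
Qed.

(** Two coordinates suffice for [w]. The vector [a] normalizes the start of the curve in
    [eq0_of_orthogonal], where [z] has the coefficient [hdot a w]. *)
Lemma exists_orthogonal n (z : 'I_n -> C) : (2 <= n)%N ->
  exists w a : 'I_n -> C, hdot z w = 0 /\ hdot a w = 1.
Proof.
case: n z => [|[|n]] // z _.
pose j0 : 'I_n.+2 := ord0; pose j1 : 'I_n.+2 := lift ord0 ord0.
have [z0|z0] := eqVneq (z j0) 0.
  by exists (fun i => (i == j0)%:R), (fun i => (i == j0)%:R);
    rewrite !hdot_delta z0.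
pose w i : C := (- (z j1 / z j0))^* * (i == j0)%:R + (i == j1)%:R.
exists w, (fun i => (i == j1)%:R).
by rewrite !hdotDr !hdotZr !hdot_delta conjCK mulr0 add0r mulNr divfK // addNr.
Qed.

(* The curve [hdot a w_s * z - hdot z w_s * a] stays orthogonal to
   [w_s = s z + (1 - s) w]; it passes through [z] at [s = 0], whereas
   [w_1 = z]. *)
Lemma eq0_of_orthogonal n (q : {mpoly C[n]}) : (2 <= n)%N ->
  (forall z w, hdot z w = 0 -> q.@[z] * (q.@[w])^* = 0) -> q = 0.
Proof.
move=> n2 q0; apply: mpoly_eq0_on_nat => v; set z : 'I_n -> C := fun i => _.
apply/eqP/negP => /negP qz.
have [w [a [zw aw]]] := exists_orthogonal z n2.
have [lin linE] : exists lin : C -> C -> {poly C},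
    forall x y s, (lin x y).[s] = x * s + y * (1 - s).
  exists (fun x y => x *: 'X + y *: (1 - 'X)) => x y s.
  by rewrite hornerD !hornerZ hornerD hornerN hornerC hornerX.
(* For natural [s], which conjugation fixes, these are [hdot a w_s] and [hdot z w_s]; so the curve
   is polynomial in [s], and so is the conjugate of [w_s]. *)
pose za := lin (hdot a z) 1; pose zz := lin (hdot z z) 0.
have [P PE] := meval_curve q (fun i => z i *: za - a i *: zz).
have [Q QE] := meval_curve (map_mpoly Num.conj q)
  (fun i => lin (z i)^* (w i)^*).
have /eqP : P * Q = 0.
  apply: (@poly_eq0_on_sequence _ (fun j : nat => j%:R)) => [i j /eqP|j].
    by rewrite eqr_nat => /eqP.
  pose ws i := j%:R * z i + (1 - j%:R) * w i.
  pose zs i := hdot a ws * z i - hdot z ws * a i.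
  have hws u : hdot u ws = j%:R * hdot u z + (1 - j%:R) * hdot u w.
    by rewrite hdotDr !hdotZr rmorphB /= conjC1 conjC_nat.
  rewrite hornerM -[RHS](q0 zs ws); last first.
    by rewrite hdotBl !hdotZl; ring.
  rewrite PE QE meval_conj; congr (_ * _); apply: meval_eq => i /=.
    by rewrite /zs !hws aw zw !(hornerD, hornerN, hornerZ) !linE; ring.
  by rewrite linE /ws rmorphD !rmorphM rmorphB /= conjC1 !conjC_nat; ring.
(* [P] at [0] is the value of [q] at [z], and [Q] at [1] is its conjugate; neither vanishes. *)
rewrite mulf_eq0 => /orP[] /eqP e.
  move: qz; have := PE 0; rewrite e horner0 => ->; apply/negP; rewrite negbK.
  apply/eqP; apply: meval_eq => i.
  by rewrite !(hornerD, hornerN, hornerZ) !linE; ring.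
move: qz; rewrite -(conjC_eq0) meval_conj.
have := QE 1; rewrite e horner0 => ->; apply/negP; rewrite negbK.
by apply/eqP; apply: meval_eq => i; rewrite linE; ring.
Qed.

(** For fixed [u], the coefficient of [x ^ k] in the restriction of [p] to the complex line through
    [u]. *)
Definition hcoef n (p : {mpoly C[n]}) (k : nat) (u : 'I_n -> C) : C :=
  (pihomog mdeg k p).@[u].

Lemma meval_homog_scale n (p : {mpoly C[n]}) k x (u : 'I_n -> C) :
  p \is k.-homog -> p.@[fun i => x * u i] = p.@[u] * x ^+ k.
Proof.
move=> /dhomogP hp; rewrite !mevalE mulr_suml [LHS]big_seq [RHS]big_seq.
apply: eq_bigr => m /hp <-; rewrite -mulrA; congr (_ * _).
rewrite /= mdegE -prodrXr -big_split; apply: eq_bigr => i _.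
by rewrite exprMn mulrC.
Qed.

Lemma meval_line n (p : {mpoly C[n]}) d x u : (msize p <= d.+1)%N ->
  p.@[fun i => x * u i] = \sum_(k < d.+1) hcoef p k u * x ^+ k.
Proof.
move=> /pihomog_partitionE {1}->; rewrite raddf_sum; apply: eq_bigr => k _ /=.
exact/meval_homog_scale/pihomogP.
Qed.

Definition pairing n N (p : 'I_N -> {mpoly C[n]}) (z w : 'I_n -> C) : C :=
  \sum_i (p i).@[z] * ((p i).@[w])^*.

(** The coefficient of [x ^ a * y^* ^ b] in the pairing at the points [x u] and [y w]. *)
Definition hpairing n N (p : 'I_N -> {mpoly C[n]}) (u w : 'I_n -> C)
  (a b : nat) : C := \sum_i hcoef (p i) a u * (hcoef (p i) b w)^*.

Lemma sesquipoly_pairing n N (p : 'I_N -> {mpoly C[n]}) :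
  sesquipoly (pairing p).
Proof.
apply: sesquipoly_sum => i.
exact: sesquipolyM (sesquipoly_holo _) (sesquipoly_antiholo _).
Qed.

Lemma pairing_line n N (p : 'I_N -> {mpoly C[n]}) d x y u w :
  (forall i, msize (p i) <= d.+1)%N ->
  pairing p (fun i => x * u i) (fun i => y * w i) =
  \sum_(a < d.+1) \sum_(b < d.+1) hpairing p u w a b * x ^+ a * y^* ^+ b.
Proof.
move=> sp; under eq_bigr do under eq_bigr do rewrite -mulrA mulr_suml.
under eq_bigr do rewrite exchange_big.
rewrite exchange_big; apply: eq_bigr => i _ /=.
rewrite !(meval_line _ _ (sp i)) rmorph_sum mulr_suml; apply: eq_bigr => a _.
rewrite mulr_sumr; apply: eq_bigr => b _.
by rewrite rmorphM rmorphXn /=; ring.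
Qed.

(** Images of the natural numbers under the Cayley transform, which takes the real line into the
    unit circle. *)
Lemma unit_points : exists2 x : nat -> C, injective x &
  forall k, x k * (x k)^* = 1.
Proof.
have ki (k : nat) : (k%:R - 'i != 0 :> C) /\ (k%:R + 'i != 0 :> C).
  have nz : (k%:R - 'i) * (k%:R + 'i) != 0 :> C.
    have -> : (k%:R - 'i) * (k%:R + 'i) = k%:R ^+ 2 - 'i ^+ 2 :> C by ring.
    by rewrite sqrCi opprK -natrX natr1 pnatr_eq0.
  by move: nz; rewrite mulf_eq0 negb_or => /andP.
exists (fun k => (k%:R + 'i) / (k%:R - 'i)) => [j k /eqP|k].
  have [j1 j2] := ki j; have [k1 k2] := ki k.
  rewrite eqr_div // => /eqP e; apply/eqP; rewrite -(eqr_nat C) -subr_eq0.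
  have : (j%:R - k%:R) * (- 2%:R * 'i) = 0 :> C.
    rewrite [LHS](_ : _ = (j%:R + 'i) * (k%:R - 'i) - (k%:R + 'i) * (j%:R - 'i)).
      by rewrite e subrr.
    by ring.
  by move/eqP; rewrite !mulf_eq0 oppr_eq0 pnatr_eq0 (negbTE (neq0Ci C)) !orbF.
have [k1 k2] := ki k.
rewrite fmorph_div rmorphD rmorphB /= !conjC_nat !conjCi opprK.
by field; rewrite ?k1 ?k2.
Qed.

Lemma hdot_norm n (z : 'I_n -> C) : hdot z z != 0 ->
  exists x (u : 'I_n -> C), [/\ 0 < x, hdot u u = 1 & z =1 (fun i => x * u i)].
Proof.
move=> z0; pose x := sqrtC (hdot z z).
have x_gt0 : 0 < x by rewrite sqrtC_gt0 lt_neqAle eq_sym z0 hdot_ge0.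
have xJ : x^-1^* = x^-1 by rewrite geC0_conj // invr_ge0 ltW.
exists x, (fun i => x^-1 * z i); split=> //.
  rewrite hdotZl hdotZr xJ -(sqrtCK (hdot z z)) -/x.
  by field; rewrite gt_eqF.
by move=> i; rewrite mulVKf // gt_eqF.
Qed.

Lemma hdot_eq n (z z' w w' : 'I_n -> C) : z =1 z' -> w =1 w' ->
  hdot z w = hdot z' w'.
Proof. by move=> e f; apply: eq_bigr => i _; rewrite e f. Qed.

Lemma pairing_eq n N (p : 'I_N -> {mpoly C[n]}) z z' w w' :
  z =1 z' -> w =1 w' ->
  pairing p z w = pairing p z' w'.
Proof.
by move=> e f; apply: eq_bigr => i _; rewrite (meval_eq _ e) (meval_eq _ f).
Qed.

(** Along the line through [u] the sphere is a circle on which the conjugate of [x] is [T / x], so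
    [circle_coef_eq0] applies to the difference of both sides. The nonzero [hcoef q k u] keeps [q]
    from vanishing on the whole line. *)
Lemma sphere_circle_coef n N (p : 'I_N -> {mpoly C[n]}) q d u T rho :
  (forall i, msize (p i) <= d.+1)%N -> (msize q <= d.+1)%N ->
  0 < T ->
  (forall z, hdot z z = T -> q.@[z] != 0 ->
     pairing p z z = rho * (q.@[z] * (q.@[z])^*)) ->
  hdot u u = 1 -> (exists2 k, (k <= d)%N & hcoef q k u != 0) ->
  forall l, (l < (d + d).+1)%N ->
  (circle_coef d (hpairing p u u) l).[T] =
  rho * (circle_coef d (fun a b => hcoef q a u * (hcoef q b u)^*) l).[T].
Proof.
move=> sp sq T0 pq u1 [k0 k0d qk0] l ltl.
apply/eqP; rewrite -subr_eq0 -hornerZ -hornerN -hornerD -circle_coefB.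
have [om om_inj om1] := unit_points.
pose r := sqrtC T.
have r0 : r != 0 by rewrite sqrtC_eq0 gt_eqF.
have rJ : r^* = r by rewrite geC0_conj // sqrtC_ge0 ltW.
have om0 k : om k != 0.
  by apply: contraTneq (oner_neq0 C) => e; rewrite -(om1 k) e mul0r eqxx.
have ex k (z := fun i => (r * om k) * u i) : hdot z z = T.
  rewrite hdotZl hdotZr u1 mulr1 rmorphM /= rJ mulrACA om1 mulr1.
  by rewrite -expr2 sqrtCK.
apply/eqP; apply: (@circle_coef_eq0 _ d _ T (fun k => r * om k)
  (\poly_(k < d.+1) hcoef q k u)) => //.
- apply: contraNneq qk0 => e; have := coef0 C k0.
  by rewrite -e coef_poly ltnS k0d => ->.
- by move=> i j /(mulfI r0)/om_inj.
- by move=> k; rewrite mulf_neq0.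
move=> k; rewrite horner_poly -meval_line // => qz.
have -> : T / (r * om k) = (r * om k)^*.
  apply: (mulfI (mulf_neq0 r0 (om0 k))).
  rewrite mulrCA divff ?mulf_neq0 // mulr1 rmorphM /= rJ mulrACA om1 mulr1.
  by rewrite -expr2 sqrtCK.
have /eqP := pq _ (ex k) qz; rewrite -subr_eq0 => /eqP e0; rewrite -[RHS]e0.
rewrite (pairing_line _ _ _ _ sp) [X in X * _^*](meval_line _ _ sq).
rewrite (meval_line _ _ sq) rmorph_sum mulr_suml mulr_sumr -sumrB.
apply: eq_bigr => a _; rewrite 2!mulr_sumr -sumrB; apply: eq_bigr => b _.
by rewrite rmorphM rmorphXn /=; ring.
Qed.

Lemma hdot_not_identically0 n : (0 < n)%N ->
  ~ (forall z w : 'I_n -> C, hdot z w = 0).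
Proof.
case: n => // n _ h; have := h (fun=> 1) (fun i => (i == ord0)%:R).
by rewrite hdot_delta => /eqP; rewrite oner_eq0.
Qed.

(** Multiplying by [hdot z w] makes the diagonal vanish at the origin too; after polarization this
    factor is cancelled. *)
Lemma sesquipoly_eq0_off_origin n F : (0 < n)%N -> sesquipoly F ->
  (forall z : 'I_n -> C, hdot z z != 0 -> F z z = 0) ->
  forall z w, F z w = 0.
Proof.
move=> n0 sF F0; apply: (sesquipoly_cancel (@sesquipoly_hdot _ n)) => //.
  apply: sesquipoly_polarization => [|z].
    exact: sesquipolyM (@sesquipoly_hdot _ n) sF.
  by have [->|/F0 ->] := eqVneq (hdot z z) 0; rewrite ?mul0r ?mulr0.
exact: hdot_not_identically0.
Qed.

Lemma sum_circle_coef_real d (K : nat -> nat -> C) x : x^* = x ->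
  \sum_(l < (d + d).+1) (circle_coef d K l).[x ^+ 2] * x ^+ l =
  x ^+ d * \sum_(a < d.+1) \sum_(b < d.+1) K a b * x ^+ a * x^* ^+ b.
Proof. by move=> xJ; rewrite expr2 sum_circle_coef xJ. Qed.

Lemma rational_sphere_identity n N d (p : 'I_N -> {mpoly C[n]}) q
    (t rho : nat -> C) :
  (0 < n)%N -> q != 0 ->
  (forall i, msize (p i) <= d.+1)%N -> (msize q <= d.+1)%N ->
  {in gtn d.+1 &, injective t} ->
  (forall j, (j < d.+1)%N -> 0 < t j) ->
  (forall j, (j < d.+1)%N -> rho j != 0) ->
  (forall j z, (j < d.+1)%N -> hdot z z = t j -> q.@[z] != 0 ->
     pairing p z z = rho j * (q.@[z] * (q.@[z])^*)) ->
  exists nu (A : {poly C}), A != 0 /\ forall z w,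
    hdot z w ^+ nu * pairing p z w = A.[hdot z w] * (q.@[z] * (q.@[w])^*).
Proof.
move=> n0 q0 sp sq t_inj t0 rho0 pq.
have [|nu qnu nu_min] := @ex_minnP (fun k => pihomog mdeg k q != 0).
  have [k qk|qk] := pickP (fun k : 'I_d.+1 => pihomog mdeg k q != 0).
    by exists k.
  case/eqP: q0; rewrite (pihomog_partitionE sq) big1 // => k _.
  exact/eqP/negbFE/qk.
(* The order [nu] of [q] at the origin does not depend on a direction, so a single [A] serves every
   line. *)
have [A sA At] := poly_interpolation (fun j => rho j * t j ^+ nu) t_inj.
have A0 : A != 0.
  apply/eqP => e; have := At 0%N isT; rewrite e horner0 => /esym/eqP.
  by rewrite mulf_eq0 (negbTE (rho0 0%N isT)) expf_eq0 gt_eqF ?t0 // andbF.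
exists nu, A; split=> //.
pose G (z w : 'I_n -> C) := hdot z w ^+ nu * pairing p z w -
  A.[hdot z w] * (q.@[z] * (q.@[w])^*).
have sG : sesquipoly G.
  have sH := @sesquipoly_hdot C n.
  apply: sesquipolyB.
    exact: sesquipolyM (sesquipolyX _ sH) (sesquipoly_pairing _).
  apply: sesquipolyM; first exact: sesquipoly_horner.
  exact: sesquipolyM (sesquipoly_holo _) (sesquipoly_antiholo _).
suff G0 : forall z w, G z w = 0.
  by move=> z w; apply/eqP; rewrite -subr_eq0; apply/eqP/G0.
(* The lowest homogeneous part of [q], as an extra factor, leaves only the directions along which
   [q] vanishes to order exactly [nu]. *)
apply: (sesquipoly_cancel (sesquipoly_holo (pihomog mdeg nu q))) => //; last first.
  move=> q_nu0; case/eqP: qnu; apply: mpoly_eq0_on_nat => v.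
  exact: (q_nu0 _ (fun=> 0)).
apply: sesquipoly_eq0_off_origin => // [|z].
  exact: sesquipolyM (sesquipoly_holo _) sG.
move=> /hdot_norm[x [u [x0 u1 zE]]].
have [->|qz] := eqVneq (pihomog mdeg nu q).@[z] 0; first by rewrite mul0r.
have qu : hcoef q nu u != 0.
  apply: contraNneq qz => qu; rewrite (meval_eq _ zE).
  by rewrite (meval_homog_scale _ _ (pihomogP _ _ _)) -/(hcoef q nu u) qu mul0r.
have q_ge k : (d < k)%N -> hcoef q k u = 0.
  move=> dk; rewrite /hcoef pihomogE big1_seq ?meval0 // => m /andP[/eqP mk mq].
  by have := leq_trans (msize_mdeg_lt mq) sq; rewrite mk ltnS leqNgt dk.
have nud : (nu <= d)%N.
  by rewrite leqNgt; apply: contraNN qu => /q_ge ->.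
(* [D] is the degree of [q] along [u], and may vary with [u]. *)
have [||D qD D_max] := @ex_maxnP (fun k => hcoef q k u != 0) d.
- by exists nu.
- by move=> k; apply: contraNT; rewrite -ltnNge => /q_ge ->.
have hKL j l : (j < d.+1)%N -> (l < (d + d).+1)%N -> _ :=
  fun jd ltl => sphere_circle_coef sp sq (t0 j jd) (fun z => pq j z jd) u1
    (ex_intro2 _ _ nu nud qu) ltl.
have key' : forall l, (l < (d + d).+1)%N ->
    'X^nu * circle_coef d (hpairing p u u) l =
    A * circle_coef d (fun a b => hcoef q a u * (hcoef q b u)^*) l.
  apply: (circle_coef_identity (D_max _ qu) _ _ _ qD _ t_inj _ sA At hKL).
  - by rewrite leqNgt; apply: contraNN qD => /q_ge ->.
  - move=> a anu; rewrite /hcoef.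
    suff -> : pihomog mdeg a q = 0 by rewrite meval0 conjC0.
    by apply/eqP; apply: contraTT anu => /nu_min; rewrite -leqNgt.
  - move=> a aD; have -> : hcoef q a u = 0; last by rewrite conjC0.
    by apply/eqP; apply: contraTT aD => /D_max; rewrite -leqNgt.
  - by rewrite conjC_eq0.
  - by move=> j /t0/lt0r_neq0.
rewrite (_ : G z z = 0) ?mulr0 //; apply/eqP; rewrite subr_eq0.
have xJ : x^* = x by rewrite geC0_conj // ltW.
have zz : hdot z z = x ^+ 2.
  by rewrite (hdot_eq zE zE) hdotZl hdotZr u1 xJ mulr1.
rewrite zz (pairing_eq _ zE zE) (pairing_line _ _ _ _ sp) (meval_eq _ zE).
rewrite !(meval_line _ _ sq).
(* Multiplied by [x ^ d], both sides become sums of circle coefficients at [x ^ 2], which [key']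
   compares term by term. *)
apply/eqP/(mulfI (expf_neq0 d (lt0r_neq0 x0))).
set S := \sum_(k < d.+1) _ * _.
have -> : S * S^* = \sum_(a < d.+1) \sum_(b < d.+1)
    (hcoef q a u * (hcoef q b u)^*) * x ^+ a * x^* ^+ b.
  rewrite rmorph_sum mulr_suml; apply: eq_bigr => a _.
  rewrite mulr_sumr; apply: eq_bigr => b _.
  by rewrite rmorphM rmorphXn /=; ring.
rewrite mulrCA -(sum_circle_coef_real d (hpairing p u u)) // [RHS]mulrCA.
rewrite -(sum_circle_coef_real d (fun a b => hcoef q a u * (hcoef q b u)^*)) //.
rewrite !mulr_sumr; apply: eq_bigr => l _; rewrite !mulrA; congr (_ * _).
have /(congr1 (horner^~ (x ^+ 2))) := key' l (ltn_ord l).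
by rewrite !hornerM hornerXn => ->.
Qed.

Lemma polynomial_sphere_identity n N d (p : 'I_N -> {mpoly C[n]})
    (t rho : nat -> C) :
  (0 < n)%N -> (0 < d)%N ->
  (forall i, msize (p i) <= d.+1)%N ->
  {in gtn d &, injective t} ->
  (forall j, (j < d)%N -> 0 < t j) ->
  (forall j, (j < d)%N -> rho j != 0) ->
  (forall j z, (j < d)%N -> hdot z z = t j -> pairing p z z = rho j) ->
  exists2 A : {poly C}, A != 0 & forall z w, pairing p z w = A.[hdot z w].
Proof.
move=> n0 d0 sp t_inj t0 rho0 pt.
(* The origin, as a sphere of radius [0], adds a node to the [d] given ones. *)
pose t' j := if j is k.+1 then t k else 0.
have t'_inj : {in gtn d.+1 &, injective t'}.
  move=> [|i] [|j] //=; rewrite !inE !ltnS => id jd e.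
  - by have := t0 j jd; rewrite -e ltxx.
  - by have := t0 i id; rewrite e ltxx.
  - by rewrite (t_inj i j).
pose o : 'I_n -> C := fun=> 0.
pose rho' j := if j is k.+1 then rho k else pairing p o o.
have [A sA At'] := poly_interpolation rho' t'_inj.
have A00 : A.[0] = pairing p o o by exact: (At' 0%N).
have At j : (j < d)%N -> A.[t j] = rho j by move=> jd; exact: (At' j.+1).
have A0 : A != 0.
  apply/eqP => e; have := rho0 0%N d0; rewrite -(At 0%N d0) e horner0.
  by rewrite eqxx.
exists A => //.
have sH := @sesquipoly_hdot C n.
suff h z w : pairing p z w - A.[hdot z w] = 0.
  by move=> z w; apply/eqP; rewrite -subr_eq0 h.
move: z w; apply: sesquipoly_eq0_off_origin => // [|z].
  apply: sesquipolyB; first exact: sesquipoly_pairing.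
  exact: sesquipoly_horner.
move=> /hdot_norm[x [u [x0 u1 zE]]].
have xJ : x^* = x by rewrite geC0_conj // ltW.
have K00 : A.[0] = hpairing p u u 0 0.
  rewrite A00 (@pairing_eq _ _ _ _ (fun i => 0 * u i) _ (fun i => 0 * u i)).
  - rewrite (pairing_line _ _ _ _ sp) (bigD1 ord0) //= (bigD1 ord0) //=.
    rewrite conjC0 !expr0 !mulr1 big1 => [|i]; last first.
      by rewrite -val_eqE /= => i0; rewrite expr0n (negbTE i0) mulr0.
    rewrite big1 ?addr0 // => i; rewrite -val_eqE /= => i0.
    by rewrite big1 // => j _; rewrite expr0n (negbTE i0) /= !(mulr0, mul0r).
  - by move=> i; rewrite mul0r.
  - by move=> i; rewrite mul0r.
(* With the denominator [1], the only nonzero circle coefficient on the right is that of [x ^ d], as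
   [circle_coef_const] expects. *)
have q1E k v : hcoef (1 : {mpoly C[n]}) k v = (k == 0)%N%:R.
  rewrite /hcoef; have [->|k0] := eqVneq k 0%N.
    by rewrite pihomog_dE ?meval1 ?dhomog1.
  by rewrite (pihomog_ne0 (d := 0%N)) ?meval0 ?dhomog1 // eq_sym.
have key : forall l, (l < (d + d).+1)%N ->
    circle_coef d (hpairing p u u) l = (l == d)%:R *: A.
  apply: (circle_coef_const t_inj (fun j jd => lt0r_neq0 (t0 j jd)) sA K00).
  move=> j l jd ltl.
  rewrite (sphere_circle_coef (q := 1) (rho := rho j) (T := t j)) ?t0 //.
  - rewrite At // mulrC; congr (_ * _); rewrite circle_coefE.
    rewrite (bigD1 ord0) //= (bigD1 ord0) //= !q1E conjC1 !addn0 eq_sym.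
    rewrite !mulr1 big1 => [|i]; last first.
      by rewrite -val_eqE /= !q1E => /negbTE ->; rewrite conjC0 !(mulr0, mul0r).
    rewrite big1 ?addr0 // => i; rewrite -val_eqE /= => /negbTE i0.
    by rewrite big1 // => k _; rewrite q1E i0 !(mulr0, mul0r).
  - by rewrite msize1.
  - by move=> y yt _; rewrite (pt j) // meval1 conjC1 !mulr1.
  - by exists 0%N; rewrite ?q1E ?oner_eq0.
rewrite (pairing_eq _ zE zE) (hdot_eq zE zE) hdotZl hdotZr u1 xJ mulr1 -expr2.
rewrite (pairing_line _ _ _ _ sp).
apply/eqP; rewrite subr_eq0; apply/eqP.
apply/(mulfI (expf_neq0 d (lt0r_neq0 x0))).
rewrite -(sum_circle_coef_real d (hpairing p u u)) //.
have ltd : (d < (d + d).+1)%N by rewrite ltnS leq_addr.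
rewrite (bigD1 (Ordinal ltd)) //= key // eqxx scale1r mulrC.
rewrite big1 ?addr0 // => l; rewrite -val_eqE /= => /negbTE ld.
by rewrite key // ld scale0r horner0 mul0r.
Qed.

(** For [nu > 0] the left side vanishes at orthogonal pairs, so [A] nonzero at [0] would force
    [q = 0]. Hence ['X] divides [A], and the powers of [hdot z w] are removed one at a time. *)
Lemma cancel_hdot_power n N (p : 'I_N -> {mpoly C[n]}) q nu (A : {poly C}) :
  (2 <= n)%N -> q != 0 -> A != 0 ->
  (forall z w,
    hdot z w ^+ nu * pairing p z w = A.[hdot z w] * (q.@[z] * (q.@[w])^*)) ->
  exists2 B : {poly C}, B != 0 &
    forall z w, pairing p z w = B.[hdot z w] * (q.@[z] * (q.@[w])^*).
Proof.
move=> n2 q0; elim: nu A => [|nu IHnu] A A0 pA.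
  by exists A => // z w; rewrite -pA mul1r.
have [rA|rA] := boolP (root A 0); last first.
  case/eqP: q0; apply: eq0_of_orthogonal => // z w zw.
  have := pA z w; rewrite zw expr0n mul0r => /esym/eqP.
  by rewrite mulf_eq0 (negbTE rA : A.[0] == 0 = false) => /eqP.
have /factor_theorem[B AB] := rA; rewrite subr0 in AB.
apply: (IHnu B) => [|z w].
  by apply: contraNneq A0 => B0; rewrite AB B0 mul0r.
have sH := @sesquipoly_hdot C n.
apply/eqP; rewrite -subr_eq0; apply/eqP; move: z w.
apply: (sesquipoly_cancel sH) => [|z w|].
- apply: sesquipolyB.
    exact: sesquipolyM (sesquipolyX _ sH) (sesquipoly_pairing _).
  apply: sesquipolyM; first exact: sesquipoly_horner.
  exact: sesquipolyM (sesquipoly_holo _) (sesquipoly_antiholo _).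
- rewrite mulrBr mulrA -exprS pA AB hornerM hornerX; ring.
- by apply: hdot_not_identically0; apply: ltnW.
Qed.

End SphereIdentities.

(** * Orthonormal bases of spans, and their completion *)

Section OrthonormalBases.
Context {C : numClosedFieldType}.
Local Open Scope sesquilinear_scope.

(** Rows are appended while some member of [X] lies outside the span, by induction on the corank.
    They are taken from [X] itself, so that what is known of its members passes to the span. *)
Lemma row_span_basis (F : fieldType) N (X : 'rV[F]_N -> Prop) :
  exists s (S : 'M[F]_(s, N)), (forall k, X (row k S)) /\
    forall x, X x -> (x <= S)%MS.
Proof.
suff grow m : forall s (S : 'M[F]_(s, N)), (N - \rank S <= m)%N ->
    (forall k, X (row k S)) ->
    exists s' (S' : 'M[F]_(s', N)), (forall k, X (row k S')) /\
      forall x, X x -> (x <= S')%MS.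
  by apply: (grow N 0%N (0 : 'M[F]_(0, N))) => [|[]//]; rewrite leq_subr.
elim: m => [|m IHm] s S rS XS;
  have [full|/boolp.existsNP[x /boolp.not_implyP[Xx /negP xS]]] :=
    boolp.EM (forall x, X x -> (x <= S)%MS); try by exists s, S.
  case/negP: xS; apply: submx_full; rewrite -col_leq_rank.
  by rewrite -subn_eq0 -leqn0.
apply: (IHm _ (col_mx S x)).
  suff : (\rank S < \rank (col_mx S x))%N.
    by have := rank_leq_col (col_mx S x); lia.
  rewrite -addsmxE; apply: rank_ltmx; rewrite ltmxE addsmxSl /=.
  by apply: contra xS => /(submx_trans _); apply; rewrite addsmxSr.
move=> k; case: (split_ordP k) => j ->.
  by rewrite rowKu.
by rewrite rowKd row_id.
Qed.

(** Gram-Schmidt on the span. [T] expresses the basis through members of [X], and [B^t* *m B] is the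
    orthogonal projection onto the span. *)
Lemma orthonormal_span N (X : 'rV[C]_N -> Prop) :
  exists r (B : 'M[C]_(r, N)) s (S : 'M[C]_(s, N)) (T : 'M[C]_(r, s)),
  [/\ B \is unitarymx, B = T *m S, forall k, X (row k S) &
      forall x, X x -> x = x *m B^t* *m B].
Proof.
have [s [S [XS SX]]] := row_span_basis X.
pose B := schmidt (row_base S).
have uB : B \is unitarymx by rewrite schmidt_unitarymx // rank_leq_col.
have BS : (B :=: S)%MS.
  exact: eqmx_trans (eqmx_schmidt_free (row_base_free S)) (eq_row_base S).
have /submxP[T TS] : (B <= S)%MS by rewrite BS.
exists (\rank S), B, s, S, T; split=> // x /SX; rewrite -BS => /submxP[y ->].
by rewrite -(mulmxA y) (unitarymxP uB) mulmx1.
Qed.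

(** An orthonormal basis of the orthogonal complement supplies the missing rows. *)
Lemma unitary_completion m n (B : 'M[C]_(m, n)) : B \is unitarymx ->
  exists E : 'M[C]_(n - m, n), col_mx B E \is unitarymx.
Proof.
move=> uB; pose B' := (orthomx Num.conj (hermitian1mx n) B).
have e : \rank B' = (n - m)%N by rewrite rank_ortho mxrank_unitary.
suff [E EE] : exists E : 'M[C]_(\rank B', n), col_mx B E \is unitarymx.
  by rewrite -e; exists E.
pose E := schmidt (row_base B').
have uE : E \is unitarymx by rewrite schmidt_unitarymx // rank_leq_col.
exists E.
apply/unitarymxP; rewrite tr_col_mx map_row_mx mul_col_row.
have EB : E *m B^t* = 0.
  apply/orthomx1P; rewrite (eqmx_schmidt_free (row_base_free B')).
  by rewrite eq_row_base.
have BE : B *m E^t* = 0.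
  by rewrite -[LHS]trmxCK trmx_mul map_mxM trmxCK EB trmx0 map_mx0.
by rewrite !(unitarymxP _) // EB BE -scalar_mx_block.
Qed.

End OrthonormalBases.

(** * Divisibility by the denominator, and the orthogonal decomposition *)

Section Decomposition.
Context {C : numClosedFieldType}.
Local Open Scope sesquilinear_scope.

Lemma mpoly_ext n (p q : {mpoly C[n]}) :
  (forall z, p.@[z] = q.@[z]) -> p = q.
Proof.
move=> pq; apply/eqP; rewrite -subr_eq0; apply/eqP.
by apply: mpoly_eq0_on_nat => v; rewrite mevalB pq subrr.
Qed.

Lemma sesquipoly_slice n F w : sesquipoly F ->
  exists s : {mpoly C[n]}, forall z, s.@[z] = F z w.
Proof.
move=> [H FH].
exists (H \mPo [tuple match split i with
  inl j => 'X_j | inr j => ((w j)^*)%:MP end | i < n + n]) => z.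
rewrite comp_mpoly_meval FH; apply: meval_eq => i; rewrite tnth_mktuple /join.
by case: (split i) => j; rewrite ?mevalXU ?mevalC.
Qed.

(* [q] divides the inner product of [p] with each of its values, hence with
   each vector of the span of these values, where [p] takes its values. *)
Lemma dvd_of_pairing n N (p : 'I_N -> {mpoly C[n]}) q (B : {poly C}) :
  (forall z w, pairing p z w = B.[hdot z w] * (q.@[z] * (q.@[w])^*)) ->
  exists a : 'I_N -> {mpoly C[n]}, forall i, p i = q * a i.
Proof.
move=> pq.
(* Conjugated values, so that the pairing with [w] is a linear form in [p] with coefficients
   [v w]. *)
pose v z : 'rV[C]_N := \row_i ((p i).@[z])^*.
have [r [M [s [S [T [uM MTS SX XM]]]]]] :=
  orthonormal_span (fun x => exists w, x = v w).
have slice k : exists t : {mpoly C[n]}, forall z,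
    q.@[z] * t.@[z] = \sum_i (p i).@[z] * S k i.
  have [w Sw] := SX k.
  have [|t tE] := @sesquipoly_slice n (fun z w => B.[hdot z w] * (q.@[w])^*) w.
    apply: sesquipolyM (sesquipoly_antiholo _).
    exact: sesquipoly_horner (@sesquipoly_hdot _ n).
  exists t => z; rewrite tE mulrCA -pq; apply: eq_bigr => i _.
  by have /rowP/(_ i) := Sw; rewrite !mxE => ->.
have [t tE] := fin_all_exists slice.
(* Conjugating the projection identity for [v z] and expanding [M = T *m S] writes [p i] through the
   sums in [slice], each of which is [q] times some [t k]. *)
exists (fun i => \sum_j (M j i)^* *: \sum_k T j k *: t k) => i.
apply: mpoly_ext => z; rewrite mevalM raddf_sum mulr_sumr /=.
have /rowP/(_ i) := XM (v z) (ex_intro _ z erefl).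
rewrite !mxE => /(congr1 Num.conj); rewrite conjCK => ->.
rewrite rmorph_sum; apply: eq_bigr => j _ /=.
rewrite rmorphM /= mevalZ mulrCA mulrC; congr (_ * _).
rewrite mxE rmorph_sum raddf_sum mulr_sumr /= MTS.
under [RHS]eq_bigr do rewrite mevalZ mulrCA tE mulr_sumr.
rewrite exchange_big; apply: eq_bigr => l _ /=.
rewrite !mxE rmorphM /= !conjCK mulr_sumr.
by apply: eq_bigr => k _; rewrite mulrCA.
Qed.

Lemma bivariate_eq0 d (M : nat -> nat -> C) :
  (forall x y : nat,
     \sum_(a < d) \sum_(b < d) M a b * x%:R ^+ a * y%:R ^+ b = 0) ->
  forall a b, (a < d)%N -> (b < d)%N -> M a b = 0.
Proof.
move=> M0 a b ad bd.
have nat_inj : injective (fun j : nat => j%:R : C).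
  by move=> i j /eqP; rewrite eqr_nat => /eqP.
have Ma (y : nat) : \sum_(b < d) M a b * y%:R ^+ b = 0.
  pose P := \poly_(a < d) \sum_(b < d) M a b * y%:R ^+ b.
  suff P0 : P = 0 by have := coef0 C a; rewrite -P0 coef_poly ad.
  apply: (poly_eq0_on_sequence nat_inj) => x.
  rewrite horner_poly -[RHS](M0 x y); apply: eq_bigr => a' _.
  by rewrite mulr_suml; apply: eq_bigr => b' _; rewrite mulrAC.
pose P := \poly_(b < d) M a b.
suff P0 : P = 0 by have := coef0 C b; rewrite -P0 coef_poly bd.
by apply: (poly_eq0_on_sequence nat_inj) => y; rewrite horner_poly.
Qed.

(** Comparison of the coefficients of [x ^ a * y ^ b] in the hypothesis at [x u] and [y w], for
    natural [x] and [y]: the right side is a polynomial in the product [x * y]. *)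
Lemma hpairing_pairing n N (g : 'I_N -> {mpoly C[n]}) (A : {poly C}) d :
  (forall z w, pairing g z w = A.[hdot z w]) ->
  (forall i, msize (g i) <= d.+1)%N -> (size A <= d.+1)%N ->
  forall u w a b, (a <= d)%N -> (b <= d)%N ->
  hpairing g u w a b = (a == b)%:R * (A`_a * hdot u w ^+ a).
Proof.
move=> gA sg sA u w a b ad bd; apply/eqP; rewrite -subr_eq0; apply/eqP.
move: a b ad bd; apply: (@bivariate_eq0 d.+1 (fun a b => hpairing g u w a b -
  (a == b)%N%:R * (A`_a * hdot u w ^+ a))) => x y.
have := gA (fun i => x%:R * u i) (fun i => y%:R * w i).
rewrite (pairing_line _ _ _ _ sg) hdotZl hdotZr conjC_nat.
rewrite (horner_coef_wide _ sA) => /eqP; rewrite -subr_eq0 -sumrB => /eqP e.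
rewrite -[RHS]e; apply: eq_bigr => a _.
rewrite (eq_bigr (fun b : 'I_d.+1 => hpairing g u w a b * x%:R ^+ a * y%:R ^+ b -
   (a == b)%:R * (A`_a * hdot u w ^+ a * x%:R ^+ a * y%:R ^+ b))); last first.
  by move=> b _; rewrite -val_eqE /=; ring.
rewrite sumrB; congr (_ - _); rewrite (bigD1 a) //= eqxx mul1r.
rewrite big1 ?addr0 => [|b ba]; last by rewrite eq_sym (negbTE ba) mul0r.
by rewrite !exprMn; ring.
Qed.

Lemma mul_castmx (S : pzRingType) m n a b (e : a = b) (M : 'M[S]_(m, a))
    (V : 'M[S]_(a, n)) :
  castmx (erefl m, e) M *m castmx (e, erefl n) V = M *m V.
Proof. by case: b / e; rewrite !castmx_id. Qed.

Lemma castmx_adjoint_unitary a b (e : a = b) (W : 'M[C]_(a, b)) :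
  W \is unitarymx -> castmx (erefl b, e) (W^t*) \is unitarymx.
Proof. by case: b / e W => W; rewrite castmx_id trmxC_unitary. Qed.

Lemma mxcol_unitary k (l : 'I_k -> nat) n (B : forall j, 'M[C]_(l j, n)) :
  (forall j, B j \is unitarymx) ->
  (forall i j, i != j -> B i *m (B j)^t* = 0) ->
  \mxcol_j B j \is unitarymx.
Proof.
move=> uB oB; apply/unitarymxP; rewrite tr_mxcol.
have -> : (\mxrow_j (B j)^T) ^ Num.conj = \mxrow_j (B j)^t*.
  by apply/matrixP => i j; rewrite !mxE.
rewrite mul_mxcol_mxrow -mxdiagZ; apply/eq_mxblock => i j.
have [<-|ij] := eqVneq i j; last exact: oB.
by rewrite conform_mx_id; apply/unitarymxP.
Qed.

Lemma meval_mulmx n a b (M : 'M[C]_(a, b)) (G : 'cV[{mpoly C[n]}]_b) z i :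
  ((map_mx (@mpolyC n C) M *m G) i 0).@[z] =
  (M *m (\col_j (G j 0).@[z])) i 0.
Proof.
rewrite !mxE raddf_sum; apply: eq_bigr => j _ /=.
by rewrite !mxE mevalM mevalC.
Qed.

Lemma pairingE n N (G : 'cV[{mpoly C[n]}]_N) z w :
  pairing (fun i => G i 0) z w =
  ((\col_i (G i 0).@[w])^t* *m (\col_i (G i 0).@[z])) 0 0.
Proof.
by rewrite mxE; apply: eq_bigr => i _; rewrite !mxE mulrC.
Qed.

(* The values of distinct homogeneous components of [G] span orthogonal
   subspaces; the columns of [U] are made of orthonormal bases of these. *)
Lemma orthogonal_decomposition n N (G : 'cV[{mpoly C[n]}]_N) (A : {poly C}) :
  (0 < n)%N ->
  (forall z w, pairing (fun i => G i 0) z w = A.[hdot z w]) ->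
  exists (U : 'M[C]_N) (k : nat) (l : 'I_k -> nat)
    (h : forall j, 'cV[{mpoly C[n]}]_(l j)) (hl : (\sum_(j < k) l j <= N)%N),
  [/\ U \is unitarymx,
      forall j, exists d c, [/\ forall i, h j i 0 \is d.-homog, 0 < c &
        forall z, pairing (fun i => h j i 0) z z = c * hdot z z ^+ d] &
      G = map_mx (@mpolyC n C) U *m castmx (subnKC hl, erefl 1%N)
            (col_mx (\mxcol_j h j) (0 : 'cV_(N - \sum_(j < k) l j)))].
Proof.
move=> n0 GA.
pose d := (\sum_i msize (G i 0%R) + size A)%N.
have sG i : (msize (G i 0%R) <= d.+1)%N.
  by rewrite leqW // /d (bigD1 i) //= -!addnA leq_addr.
have sA : (size A <= d.+1)%N by rewrite leqW // leq_addl.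
pose v a z : 'cV[C]_N := \col_i hcoef (G i 0) a z.
have vv a b z w : (a <= d)%N -> (b <= d)%N ->
    (v b w)^t* *m v a z = ((a == b)%:R * (A`_a * hdot z w ^+ a))%:M.
  move=> ad bd; rewrite -(hpairing_pairing GA sG sA) //.
  apply/matrixP => i j; rewrite !ord1 !mxE eqxx mulr1n.
  by apply: eq_bigr => m _; rewrite !mxE mulrC.
have v_sum z : \col_i (G i 0).@[z] = \sum_(a <- iota 0 d.+1) v a z.
  apply/colP => i; rewrite mxE summxE -[iota 0 _]/(index_iota 0 d.+1) big_mkord.
  rewrite {1}(pihomog_partitionE (sG i)) raddf_sum.
  by apply: eq_bigr => a _; rewrite mxE.
(* Degrees at which [A] has coefficient zero are left out: the component there has norm zero, which
   is [vG] below. *)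
pose degs := [seq a <- iota 0 d.+1 | A`_a != 0].
pose deg (j : 'I_(size degs)) := nth 0%N degs j.
have deg_in j : deg j \in degs by rewrite mem_nth.
have deg_le j : (deg j <= d)%N.
  by move: (deg_in j); rewrite mem_filter mem_iota => /and3P[].
have deg_neq0 j : A`_(deg j) != 0.
  by move: (deg_in j); rewrite mem_filter => /andP[].
have deg_inj i j : i != j -> deg i != deg j.
  move=> ij; rewrite /deg nth_uniq ?ltn_ord //.
  by rewrite filter_uniq // iota_uniq.
(* The dimension of each span is found along with its basis, hence a tagged matrix. The basis
   annihilates whatever is orthogonal to the span, and the projection fixes the values. *)
have bases j : exists rB : {r : nat & 'M[C]_(r, N)},
    [/\ tagged rB \is unitarymx,
     forall m (y : 'M[C]_(N, m)), (forall w, (v (deg j) w)^t* *m y = 0) ->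
       tagged rB *m y = 0 &
     forall z, (tagged rB)^t* *m (tagged rB *m v (deg j) z) = v (deg j) z].
  have [r [B [s [S [T [uB BTS SX XB]]]]]] :=
    orthonormal_span (fun x => exists w, x = (v (deg j) w)^t*).
  exists (Tagged (fun r => 'M[C]_(r, N)) B); split=> //= [m y vy|z].
    rewrite BTS -mulmxA; suff -> : S *m y = 0 by rewrite mulmx0.
    apply/row_matrixP => k; have [w Sw] := SX k.
    by rewrite row_mul Sw vy row0.
  rewrite -[RHS]trmxCK {1}(XB _ (ex_intro _ z erefl)).
  by rewrite !(trmx_mul, map_mxM) !trmxCK.
have {bases}[rB /all_and3[uB vB Bv]] := fin_all_exists bases.
pose l j := tag (rB j); pose B j : 'M[C]_(l j, N) := tagged (rB j).
have oB i j : i != j -> B i *m (B j)^t* = 0.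
  move=> ij; apply: (vB i) => w.
  have -> : (v (deg i) w)^t* *m (B j)^t* = (B j *m v (deg i) w)^t*.
    by rewrite trmx_mul map_mxM.
  rewrite (vB j) ?trmx0 ?map_mx0 // => w'.
  by rewrite vv // (negbTE (deg_inj _ _ ij)) mul0r raddf0.
have uM := mxcol_unitary uB oB.
have hl : (\sum_(j < size degs) l j <= N)%N.
  by rewrite -(mxrank_unitary uM) rank_leq_col.
have [E uE] := unitary_completion uM.
pose h j := map_mx (@mpolyC n C) (B j) *m G.
(* The components of other degrees are orthogonal to this span, so [B j] annihilates them. *)
have BvG j z : B j *m (\col_i (G i 0).@[z]) = B j *m v (deg j) z.
  rewrite v_sum mulmx_sumr (bigD1_seq (deg j)) ?iota_uniq ?mem_iota ?ltnS //;
    last exact: deg_le.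
  rewrite big1_seq => [|a /andP[aj]]; first exact: addr0.
  rewrite mem_iota ltnS => ad.
  by apply: (vB j) => w; rewrite vv // (negbTE aj) mul0r raddf0.
(* The adjoint turns coordinates back into vectors; its columns coming from [E] meet the zero
   block. *)
exists (castmx (erefl N, subnKC hl) ((col_mx (\mxcol_j B j) E)^t*)).
exists (size degs), l, h, hl; split.
- exact: castmx_adjoint_unitary.
- move=> j; exists (deg j), A`_(deg j).
  have h_norm z : pairing (fun i => h j i 0) z z =
      A`_(deg j) * hdot z z ^+ deg j.
    have hE : \col_i (h j i 0).@[z] = B j *m v (deg j) z.
      by rewrite -BvG; apply/colP => i; rewrite mxE meval_mulmx.
    rewrite pairingE hE trmx_mul map_mxM -mulmxA Bv vv // eqxx mul1r.
    by rewrite mxE eqxx.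
  split=> // [i|].
    have -> : h j i 0 = \sum_k B j i k *: pihomog mdeg (deg j) (G k 0).
      apply: mpoly_ext => z; rewrite meval_mulmx BvG mxE raddf_sum.
      by apply: eq_bigr => k _; rewrite /= mevalZ mxE.
    by apply: rpred_sum => k _; apply/dhomogZ/pihomogP.
  (* At a unit vector the squared norm of [h j] is the coefficient itself, which is therefore
     positive. *)
  pose e0 (i : 'I_n) : C := (i == Ordinal n0)%:R.
  have e1 : hdot e0 e0 = 1 by rewrite hdot_delta /e0 eqxx.
  have := h_norm e0; rewrite e1 expr1n mulr1 lt_neqAle eq_sym deg_neq0 => <-.
  by apply: sumr_ge0 => i _; apply: mul_conjC_ge0.
rewrite map_castmx mul_castmx tr_col_mx !map_row_mx mul_row_col mulmx0 addr0.
have -> : map_mx (@mpolyC n C) (map_mx Num.conj (\mxcol_j B j)^T) =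
    \mxrow_j map_mx (@mpolyC n C) ((B j)^t*).
  by apply/matrixP => i j; rewrite !mxE.
rewrite mul_mxrow_mxcol; apply/colP => i; apply: mpoly_ext => z.
have vG (a : nat) : (a <= d)%N -> A`_a == 0 -> v a z = 0.
  move=> ad /eqP Aa; apply/colP => m; rewrite [RHS]mxE.
  have := vv a a z z ad ad; rewrite Aa mul0r mulr0 => /matrixP/(_ 0 0).
  rewrite !mxE mul0rn => /eqP; rewrite psumr_eq0 => [/allP/(_ m)|k _].
    by rewrite mem_index_enum !mxE mulrC mul_conjC_eq0 => /(_ isT)/eqP.
  by rewrite !mxE mulrC mul_conjC_ge0.
have -> : (G i 0).@[z] = (\sum_j v (deg j) z) i 0.
  have := v_sum z => /colP/(_ i); rewrite mxE => ->; congr (fun_of_matrix _ i 0).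
  transitivity (\sum_(a <- degs) v a z); last first.
    by rewrite (big_nth 0%N) big_mkord.
  rewrite big_filter [RHS]big_mkcond; apply: eq_big_seq => a.
  rewrite mem_iota ltnS => /andP[_ ad].
  by have [/(vG a ad)|] := boolP (A`_a == 0).
rewrite !summxE raddf_sum; apply: eq_bigr => j _.
by rewrite /= /h mulmxA -map_mxM meval_mulmx -mulmxA BvG Bv.
Qed.

End Decomposition.

(** * Rational maps: from spheres to radial norms, and back *)

Section RationalMaps.
Context {R : realType}.
Local Notation C := R[i].

Lemma sqr_enorm n (z : 'cV[C]_n) :
  ((enorm z ^+ 2)%:C)%C = hdot (fun i => z i 0) (fun i => z i 0).
Proof.
rewrite sqr_sqrtr ?sumr_ge0 // => [|i _]; last exact: sqr_ge0.
rewrite rmorph_sum; apply: eq_bigr => i _; rewrite /= rmorphXn -normCK.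
by congr (_ ^+ 2).
Qed.

Lemma enorm_eq n (z : 'cV[C]_n) (r : R) : 0 <= r ->
  hdot (fun i => z i 0) (fun i => z i 0) = ((r ^+ 2)%:C)%C -> enorm z = r.
Proof.
move=> r0; rewrite -sqr_enorm => /complexI /eqP.
by rewrite eqrXn2 // ?sqrtr_ge0 // => /eqP.
Qed.

Lemma hdot_pmap_eval n N (g : 'cV[{mpoly C[n]}]_N) (z : 'cV[C]_n) :
  hdot (fun i => pmap_eval g z i 0) (fun i => pmap_eval g z i 0) =
  pairing (fun i => g i 0) (fun i => z i 0) (fun i => z i 0).
Proof. by apply: eq_bigr => i _; rewrite mxE. Qed.

Lemma hdot_rat_eval n N (f : ratmap R n N) (z : 'cV[C]_n) :
  hdot (fun i => rat_eval f z i 0) (fun i => rat_eval f z i 0) =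
  (peval (rden f) z)^-1 * ((peval (rden f) z)^-1)^* *
  pairing (fun i => rnum f i 0) (fun i => z i 0) (fun i => z i 0).
Proof.
rewrite -hdot_pmap_eval mulr_sumr; apply: eq_bigr => i _.
by rewrite [rat_eval _ _ _ _]mxE rmorphM /=; ring.
Qed.

Lemma maps_sphere_pairing n N (f : ratmap R n N) (r s : R) (z : 'I_n -> C) :
  0 <= r -> maps_sphere f r s -> hdot z z = ((r ^+ 2)%:C)%C ->
  (rden f).@[z] != 0 ->
  pairing (fun i => rnum f i 0) z z =
  ((s ^+ 2)%:C)%C * ((rden f).@[z] * ((rden f).@[z])^*).
Proof.
move=> r0 fs zr qz; pose y := \col_i z i.
have yz : (fun i => y i 0) =1 z by move=> i; rewrite mxE.
have qy : peval (rden f) y = (rden f).@[z] by exact: meval_eq.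
have <- : enorm (rat_eval f y) = s.
  apply: fs; first by apply: enorm_eq; rewrite // (hdot_eq yz yz).
  by rewrite /is_pole qy; apply/eqP.
rewrite sqr_enorm hdot_rat_eval qy (pairing_eq _ yz yz) fmorphV.
have qzJ : ((rden f).@[z])^* != 0 by rewrite conjC_eq0.
by field; rewrite qz qzJ.
Qed.

(** Common ground of the finite and infinite cases, with radii indexed by naturals as in the
    interpolation lemmas. *)
Definition maps_spheres n N m (f : ratmap R n N) : Prop :=
  exists r s : nat -> R,
    [/\ forall j, (j < m)%N -> 0 < r j /\ 0 < s j,
        {in gtn m &, injective r} &
        forall j, (j < m)%N -> maps_sphere f (r j) (s j)].

Lemma finite_fold_maps_spheres n N m (f : ratmap R n N) : (0 < m)%N ->
  finite_fold_sphere_map m f -> maps_spheres m f.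
Proof.
case: m => // m _ [r [s [rs0 r_mono _ frs]]].
exists (fun j => r (inord j)), (fun j => s (inord j)); split=> // i j im jm e.
have [ij|ji|//] := ltngtP i j.
  by have := r_mono (inord i) (inord j); rewrite e ltxx !inordK // => /(_ ij).
by have := r_mono (inord j) (inord i); rewrite e ltxx !inordK // => /(_ ji).
Qed.

Lemma infinite_fold_maps_spheres n N m (f : ratmap R n N) :
  infinite_fold_sphere_map f -> maps_spheres m f.
Proof.
by move=> [r [s [rs0 r_inj _ frs]]]; exists r, s; split=> // i j _ _ /r_inj.
Qed.

Lemma sqr_real_complex_inj m (r : nat -> R) :
  (forall j, (j < m)%N -> 0 < r j) -> {in gtn m &, injective r} ->
  {in gtn m &, injective (fun j => ((r j ^+ 2)%:C)%C)}.
Proof.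
move=> r0 r_inj i j im jm /complexI /eqP.
by rewrite eqrXn2 ?ltW ?r0 // => /eqP e; apply: r_inj.
Qed.

(** Polarized form of [|g(z)|^2 = A(|z|^2)]; [A != 0] excludes the zero map, whose image spheres
    would have radius [0]. *)
Definition radial_norm n N (g : 'cV[{mpoly C[n]}]_N) : Prop :=
  exists2 A : {poly C}, A != 0 &
    forall z w, pairing (fun i => g i 0) z w = A.[hdot z w].

(** The denominator divides the numerator and itself, so lowest terms make it constant. *)
Lemma rden_constant n N (f : ratmap R n N) (g : 'cV[{mpoly C[n]}]_N) :
  rat_eq_pmap f g -> exists2 c, c != 0 & rden f = c%:MP.
Proof.
move=> fg; have := ratmap_lowest_terms fg (esym (mulr1 (rden f))).
move=> /msize1_polyC qE; exists ((rden f)@_0) => //.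
by apply: contraNneq (rden_neq0 f) => c0; rewrite qE c0 mpolyC0.
Qed.

Lemma rational_radial_norm n N d (f : ratmap R n N) : (2 <= n)%N ->
  maps_spheres d.+1 f -> (rat_degree f <= d)%N ->
  exists2 g, rat_eq_pmap f g & radial_norm g.
Proof.
move=> n2 [r [s [rs0 r_inj frs]]] fd.
have size_le (x : {mpoly C[n]}) : (mdegree x <= d)%N -> (msize x <= d.+1)%N.
  by rewrite /mdegree; case: (msize x).
have sp i : (msize (rnum f i 0%R) <= d.+1)%N.
  apply/size_le/(leq_trans _ fd); rewrite leq_max.
  by rewrite (leq_bigmax (F := fun i => mdegree (rnum f i 0%R))).
have sq : (msize (rden f) <= d.+1)%N.
  by apply/size_le/(leq_trans _ fd); rewrite leq_maxr.
have [|j jd|j jd|j z jd|nu [A [A0 pA]]] := @rational_sphere_identity _ n N d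
  (fun i => rnum f i 0) (rden f) (fun j => ((r j ^+ 2)%:C)%C)
  (fun j => ((s j ^+ 2)%:C)%C) (ltnW n2) (rden_neq0 f) sp sq.
- by apply: sqr_real_complex_inj => // j /rs0[].
- by have [rj _] := rs0 j jd; rewrite ltcR exprn_gt0.
- have [_ sj] := rs0 j jd; apply: lt0r_neq0.
  by rewrite ltcR exprn_gt0.
- move=> zr qz; have [rj _] := rs0 j jd.
  exact: maps_sphere_pairing (ltW rj) (frs j jd) zr qz.
have [B B0 pB] := cancel_hdot_power n2 (rden_neq0 f) A0 pA.
have [a pa] := dvd_of_pairing pB.
pose g := \col_i a i.
have fg : rat_eq_pmap f g.
  by apply/colP => i; rewrite pa !mxE.
exists g => //; exists B => // z w.
(* With the denominator equal to [c], the factor [c * c^*] appears on both sides and cancels. *)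
have [c c0 qE] := rden_constant fg.
have := pB z w; rewrite qE !mevalC => e.
apply: (mulfI (mulf_neq0 c0 _ : c * c^* != 0)); first by rewrite conjC_eq0.
rewrite [RHS]mulrC -e mulr_sumr; apply: eq_bigr => i _.
by rewrite pa qE !mevalM !mevalC mxE rmorphM /=; ring.
Qed.

Lemma polynomial_radial_norm n N d (f : ratmap R n N)
    (g : 'cV[{mpoly C[n]}]_N) : (0 < n)%N -> (0 < d)%N ->
  maps_spheres d f -> rat_eq_pmap f g -> (rat_degree f <= d)%N ->
  radial_norm g.
Proof.
move=> n0 d0 [r [s [rs0 r_inj frs]]] fg fd.
have [c c0 qE] := rden_constant fg.
have pE i : rnum f i 0 = c *: g i 0 by rewrite fg qE mxE mul_mpolyC.
have sg i : (msize (g i 0%R) <= d.+1)%N.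
  rewrite -(msizeZ _ c0) -pE.
  have : (mdegree (rnum f i 0%R) <= d)%N.
    apply: leq_trans fd; rewrite leq_max.
    by rewrite (leq_bigmax (F := fun i => mdegree (rnum f i 0%R))).
  by rewrite /mdegree; case: (msize _).
apply: (@polynomial_sphere_identity _ n N d (fun i => g i 0)
  (fun j => ((r j ^+ 2)%:C)%C) (fun j => ((s j ^+ 2)%:C)%C)) => //
  [|j jd|j jd|j z jd zr].
- by apply: sqr_real_complex_inj => // j /rs0[].
- by have [rj _] := rs0 j jd; rewrite ltcR exprn_gt0.
- have [_ sj] := rs0 j jd; apply: lt0r_neq0.
  by rewrite ltcR exprn_gt0.
have [rj _] := rs0 j jd; have cJ0 : c^* != 0 by rewrite conjC_eq0.
have := maps_sphere_pairing (ltW rj) (frs j jd) zr.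
rewrite qE mevalC => /(_ c0) e; apply: (mulfI (mulf_neq0 c0 cJ0)).
rewrite [RHS]mulrC -e mulr_sumr; apply: eq_bigr => i _.
by rewrite pE !mevalZ rmorphM /=; ring.
Qed.

Lemma no_poles n N (f : ratmap R n N) (g : 'cV[{mpoly C[n]}]_N) r :
  rat_eq_pmap f g -> poles_miss_sphere f r.
Proof.
move=> /rden_constant[c c0 qE] z _.
by rewrite /is_pole /peval qE mevalC; apply/eqP.
Qed.

(** The coefficient is the squared norm of the component of degree [a] at a unit vector. *)
Lemma radial_norm_coef_ge0 n N (g : 'cV[{mpoly C[n]}]_N) (A : {poly C}) a :
  (0 < n)%N -> (forall z w, pairing (fun i => g i 0) z w = A.[hdot z w]) ->
  0 <= A`_a.
Proof.
move=> n0 gA; pose d := (a + \sum_i msize (g i 0%R) + size A)%N.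
pose e (i : 'I_n) : C := (i == Ordinal n0)%:R.
have e1 : hdot e e = 1 by rewrite hdot_delta /e eqxx.
have -> : A`_a = hpairing (fun i => g i 0) e e a a.
  rewrite (hpairing_pairing (d := d) gA).
  - by rewrite eqxx e1 expr1n !mul1r mulr1.
  - by move=> i; rewrite leqW // /d (bigD1 i) //= -addnA addnCA -addnA leq_addr.
  - by rewrite leqW // leq_addl.
  - by rewrite /d -addnA leq_addr.
  - by rewrite /d -addnA leq_addr.
by apply: sumr_ge0 => i _; apply: mul_conjC_ge0.
Qed.

(** The coefficients of [A] are nonnegative and not all zero, so [A] is positive at [r ^ 2]; the
    image radius is the square root of that value. *)
Lemma radial_norm_maps_spheres n N (f : ratmap R n N)
    (g : 'cV[{mpoly C[n]}]_N) :
  (0 < n)%N -> rat_eq_pmap f g -> radial_norm g ->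
  exists s : R -> R, forall r, 0 < r -> 0 < s r /\ maps_sphere f r (s r).
Proof.
move=> n0 fg [A A0 gA].
have A_ge0 a := radial_norm_coef_ge0 a n0 gA.
pose T r : C := A.[((r ^+ 2)%:C)%C].
have T_gt0 r : 0 < r -> 0 < T r.
  move=> r0; have r2 : 0 < ((r ^+ 2)%:C)%C :> C by rewrite ltcR exprn_gt0.
  have term_ge0 (a : 'I_(size A)) : 0 <= A`_a * ((r ^+ 2)%:C)%C ^+ a.
    by rewrite mulr_ge0 // exprn_ge0 // ltW.
  rewrite lt_neqAle /T horner_coef sumr_ge0 // andbT eq_sym.
  rewrite psumr_neq0 //; apply/hasP.
  have sA : ((size A).-1 < size A)%N by rewrite prednK // size_poly_gt0.
  exists (Ordinal sA); first exact: mem_index_enum.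
  rewrite /= pmulr_lgt0 ?exprn_gt0 // lt_neqAle A_ge0 eq_sym.
  by rewrite lead_coef_eq0 A0.
exists (fun r => Num.sqrt (complex.Re (T r))) => r r0.
have TR : T r = ((complex.Re (T r))%:C)%C.
  by rewrite RRe_real // ger0_real // ltW // T_gt0.
have Re_gt0 : 0 < complex.Re (T r) by rewrite -ltcR -TR T_gt0.
split=> [|z zr _]; first by rewrite sqrtr_gt0.
apply: enorm_eq; first exact: sqrtr_ge0.
rewrite sqr_sqrtr ?ltW // -TR hdot_rat_eval.
have [c c0 qE] := rden_constant fg.
have cJ0 : c^* != 0 by rewrite conjC_eq0.
have -> : T r = pairing (fun i => g i 0) (fun i => z i 0) (fun i => z i 0).
  by rewrite gA -sqr_enorm zr.
rewrite /peval qE mevalC fmorphV mulr_sumr; apply: eq_bigr => i _.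
have -> : rnum f i 0 = c *: g i 0 by rewrite fg qE mxE mul_mpolyC.
by rewrite !mevalZ rmorphM /=; field; rewrite c0 cJ0.
Qed.

Lemma radial_norm_infinite_fold n N (f : ratmap R n N)
    (g : 'cV[{mpoly C[n]}]_N) :
  (0 < n)%N -> rat_eq_pmap f g -> radial_norm g -> infinite_fold_sphere_map f.
Proof.
move=> n0 fg /(radial_norm_maps_spheres n0 fg)[s frs].
have r0 j : 0 < j.+1%:R :> R by rewrite ltr0n.
exists (fun j => j.+1%:R), (fun j => s j.+1%:R); split=> [j|i j|j|j].
- by have [sj _] := frs _ (r0 j).
- by move=> /eqP; rewrite eqr_nat => /eqP[].
- exact: no_poles fg.
- by have [_ fj] := frs _ (r0 j).
Qed.

Lemma homogeneous_sphere_mapP n l (h : 'cV[{mpoly C[n]}]_l) d c :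
  (forall i, h i 0 \is d.-homog) -> 0 < c ->
  (forall z, pairing (fun i => h i 0) z z = c * hdot z z ^+ d) ->
  homogeneous_sphere_map h.
Proof.
move=> h_homog c0 hc; split; first by exists d.
have cR : c = ((complex.Re c)%:C)%C by rewrite RRe_real // ger0_real // ltW.
have Re_gt0 : 0 < complex.Re c by rewrite -ltcR -cR.
exists 1, (Num.sqrt (complex.Re c)); split=> [||z z1]; rewrite ?sqrtr_gt0 //.
apply: enorm_eq; first exact: sqrtr_ge0.
rewrite sqr_sqrtr ?ltW // -cR hdot_pmap_eval hc -sqr_enorm z1.
by rewrite !expr1n mulr1.
Qed.

End RationalMaps.

Theorem theorem1p4 (R : realType) (n N : nat) (hn : (2 <= n)%N)
    (hN : (1 <= N)%N) (m : option nat)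
    (hm : forall k : nat, m = Some k -> (1 <= k)%N)
    (f : ratmap R n N) (hf : fold_sphere_map m f) :
  [/\ (forall k : nat, m = Some k ->
         is_polynomial f -> (rat_degree f <= k)%N ->
         infinite_fold_sphere_map f),
      (forall k : nat, m = Some k ->
         (rat_degree f <= k - 1)%N ->
         infinite_fold_sphere_map f) &
      (infinite_fold_sphere_map f ->
         [/\ is_polynomial f,
             (forall r : R, 0 < r ->
                exists s : R,
                  [/\ 0 < s, poles_miss_sphere f r & maps_sphere f r s]) &
             (exists (U : 'M[R[i]]_N) (k : nat) (l : 'I_k -> nat)
                (h : forall j : 'I_k, 'cV[{mpoly R[i][n]}]_(l j))
                (hl : (\sum_(j < k) l j <= N)%N),
                [/\ U \is unitarymx,
                    (forall j : 'I_k, homogeneous_sphere_map (h j)) &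
                    rat_eq_pmap f (mulmx_pmap U (oplus0 h hl))])])].
Proof.
have n0 := ltnW hn.
split=> [k mk [g fg] fk|k mk fk|f_inf].
- have k0 := hm k mk; rewrite mk in hf.
  apply: (radial_norm_infinite_fold n0 fg).
  exact: polynomial_radial_norm (finite_fold_maps_spheres k0 hf) fg fk.
- have k0 := hm k mk; rewrite mk in hf.
  (* As [k] is positive, the [k] spheres exceed the degree bound [k - 1] by one. *)
  have fS : maps_spheres (k - 1).+1 f.
    by rewrite subn1 prednK //; apply: finite_fold_maps_spheres.
  have [g fg gN] := rational_radial_norm hn fS fk.
  exact: radial_norm_infinite_fold fg gN.
(* Among infinitely many spheres, one more than the degree of [f] are selected. *)
have [g fg gN] := rational_radial_norm hn
  (infinite_fold_maps_spheres _ f_inf) (leqnn (rat_degree f)).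
split; first by exists g.
  have [s frs] := radial_norm_maps_spheres n0 fg gN.
  move=> r r0; exists (s r); have [sr fr] := frs r r0.
  by split=> //; apply: no_poles fg.
have [A A0 gA] := gN.
have [U [k [l [h [hl [uU hh gE]]]]]] := orthogonal_decomposition n0 gA.
exists U, k, l, h, hl; split=> // [j|]; last by rewrite /rat_eq_pmap fg gE.
have [d [c [h_homog c0 hc]]] := hh j.
exact: homogeneous_sphere_mapP h_homog c0 hc.
Qed.
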